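(* Let $\theta>0$, $h>0$, and let $B=\mathcal{C}([0,h])$ be the Banach space of real-valued continuous functions on $[0,h]$ with the supremum norm. Let $\{\xi_t,\ t\in\mathbb{R}\}$ be the Ornstein-Uhlenbeck process with parameter $\theta$, and let $X_n(t)=\xi_{nh+t}$, $0\le t\le h$, $n\in\mathbb{Z}$. Then $X=\{X_n,\ n\in\mathbb{Z}\}$ defines the unique stationary solution, in the Banach space $B$, to the equation $$X_n=\rho_\theta(X_{n-1})+\varepsilon_n,\quad n\in\mathbb{Z},$$ admitting a MAB($\infty$) representation.
   Context: $W=\{W_t,\ t\in\mathbb{R}\}$ is a standard bilateral (two-sided) Wiener process on a probability space $(\Omega,\mathcal{A},\mathcal{P})$. The Ornstein-Uhlenbeck (O.U.) process with parameter $\theta>0$ is the zero-mean Gaussian process with continuous sample paths $\xi_t=\int_{-\infty}^{t}e^{-\theta(t-s)}\,dW_s$, $t\in\mathbb{R}$. The operator $\rho_\theta$ on $B$ is $\rho_\theta(x)(t)=e^{-\theta t}x(h)$, and the innovations are $\varepsilon_n(t)=\int_{nh}^{nh+t}e^{-\theta(nh+t-s)}\,dW_s$, for $0\le t\le h$, $n\in\mathbb{Z}$. A MAB($\infty$) representation is a representation of $X$ as a Banach-valued moving average of infinite order, that is, $X_n=\sum_{k=0}^{+\infty}\rho_\theta^k(\varepsilon_{n-k})$, $n\in\mathbb{Z}$, where $\rho_\theta^k$ is the $k$-fold composition of $\rho_\theta$ and $\rho_\theta^0$ is the identity. *)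

(* Defs.v *)
From HB Require Import structures.
From mathcomp Require Import all_boot all_order all_algebra.
From mathcomp Require Import ring.
From mathcomp Require Import all_classical all_reals all_analysis.

Set Implicit Arguments.
Unset Strict Implicit.
Unset Printing Implicit Defensive.

Import Order.TTheory GRing.Theory Num.Theory.
Import numFieldNormedType.Exports.

Local Open Scope classical_set_scope.
Local Open Scope ring_scope.

(** * The Banach space C([0, h]) *)

(** [set_type] carries the topology induced by [R], so [C0 h] consists of the
    real functions on [0, h] that are continuous there. *)
Record C0 {R : realType} (h : {posnum R}) := MkC0 {
  C0_fun :> set_type `[0%R, h%:num] -> R;
  C0_cts : continuous C0_fun }.

Section C0_theory.
Context {R : realType} (h : {posnum R}).

Local Notation I := (set_type `[0%R, h%:num]).

HB.instance Definition _ := gen_eqMixin (C0 h).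
HB.instance Definition _ := gen_choiceMixin (C0 h).

Lemma C0P (x y : C0 h) : x = y <-> x =1 y.
Proof.
split=> [->//|/funext]; case: x y => [x cx] [y cy] /= xy.
by rewrite xy in cx *; congr MkC0; exact: Prop_irrelevance.
Qed.

Fact cts_zero : continuous (fun _ : I => 0 : R).
Proof. exact: cst_continuous. Qed.

Fact cts_opp (x : C0 h) : continuous (fun t => - x t).
Proof. by move=> t; apply: continuousN; exact: C0_cts. Qed.

Fact cts_add (x y : C0 h) : continuous (fun t => x t + y t).
Proof. by move=> t; apply: continuousD; exact: C0_cts. Qed.

Fact cts_scale (a : R) (x : C0 h) : continuous (fun t => a * x t).
Proof. by move=> t; apply: continuousM; [exact: cst_continuous|exact: C0_cts]. Qed.

Definition C0_zero : C0 h := @MkC0 R h _ cts_zero.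
Definition C0_opp (x : C0 h) : C0 h := @MkC0 R h _ (@cts_opp x).
Definition C0_add (x y : C0 h) : C0 h := @MkC0 R h _ (@cts_add x y).
Definition C0_scale (a : R) (x : C0 h) : C0 h := @MkC0 R h _ (@cts_scale a x).

Fact C0_addA : associative C0_add.
Proof. by move=> x y z; apply/C0P => t; exact: addrA. Qed.
Fact C0_addC : commutative C0_add.
Proof. by move=> x y; apply/C0P => t; exact: addrC. Qed.
Fact C0_add0 : left_id C0_zero C0_add.
Proof. by move=> x; apply/C0P => t; exact: add0r. Qed.
Fact C0_addN : left_inverse C0_zero C0_opp C0_add.
Proof. by move=> x; apply/C0P => t; exact: addNr. Qed.

HB.instance Definition _ :=
  GRing.isZmodule.Build (C0 h) C0_addA C0_addC C0_add0 C0_addN.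

Fact C0_scaleA a b x : C0_scale a (C0_scale b x) = C0_scale (a * b) x.
Proof. by apply/C0P => t; exact: mulrA. Qed.
Fact C0_scale1 : left_id 1 C0_scale.
Proof. by move=> x; apply/C0P => t; exact: mul1r. Qed.
Fact C0_scaleDr : right_distributive C0_scale +%R.
Proof. by move=> a x y; apply/C0P => t; exact: mulrDr. Qed.
Fact C0_scaleDl x : {morph C0_scale^~ x : a b / a + b}.
Proof. by move=> a b; apply/C0P => t; exact: mulrDl. Qed.

HB.instance Definition _ := GRing.Zmodule_isLmodule.Build R (C0 h)
  C0_scaleA C0_scale1 C0_scaleDr C0_scaleDl.

Lemma C0_addE (x y : C0 h) t : (x + y) t = x t + y t. Proof. by []. Qed.
Lemma C0_oppE (x : C0 h) t : (- x) t = - x t. Proof. by []. Qed.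
Lemma C0_scaleE a (x : C0 h) t : (a *: x) t = a * x t. Proof. by []. Qed.
Lemma C0_zeroE t : (0 : C0 h) t = 0. Proof. by []. Qed.

Definition C0_norm (x : C0 h) : R := sup (range (fun t => `|x t|)).

Fact inI0 : 0%R \in [set` `[0%R, h%:num]].
Proof. by rewrite inE/= in_itv/= lexx ge0. Qed.
Fact inIh : h%:num%R \in [set` `[0%R, h%:num]].
Proof. by rewrite inE/= in_itv/= lexx ge0. Qed.

Definition C0_end : I := exist _ h%:num inIh.

Lemma C0_bounded (x : C0 h) : has_sup (range (fun t => `|x t|)).
Proof.
split; first by exists `|x C0_end|, C0_end.
have /subspace_valL_continuousP cx := @C0_cts R h x.
have /compact_bounded[M [_ xM]] :=
  continuous_compact cx (segment_compact (a := 0) (b := h%:num)).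
exists (M + 1) => _ [t _ <-]; apply: (xM (M + 1)); first by rewrite ltrDl.
exists (set_val t); first exact: set_valP.
exact: (congr1 (@^~ t) (valLK point (C0_fun x))).
Qed.

Lemma C0_norm_ub (x : C0 h) t : `|x t| <= C0_norm x.
Proof. by apply: sup_upper_bound; [exact: C0_bounded|exists t]. Qed.

Lemma C0_norm_le (x : C0 h) M : (forall t, `|x t| <= M) -> C0_norm x <= M.
Proof.
move=> xM; apply: ge_sup; first by case: (C0_bounded x).
by move=> _ [t _ <-].
Qed.

Fact C0_normD x y : C0_norm (x + y) <= C0_norm x + C0_norm y.
Proof.
apply: C0_norm_le => t; rewrite C0_addE (le_trans (ler_normD _ _))//.
by rewrite lerD// C0_norm_ub.
Qed.

Fact C0_norm_ge0 x : 0 <= C0_norm x.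
Proof. exact: le_trans (normr_ge0 _) (C0_norm_ub x C0_end). Qed.

Fact C0_normZ_le a x : C0_norm (a *: x) <= `|a| * C0_norm x.
Proof.
apply: C0_norm_le => t; rewrite C0_scaleE normrM.
by rewrite ler_wpM2l// C0_norm_ub.
Qed.

Fact C0_normZ a x : C0_norm (a *: x) = `|a| * C0_norm x.
Proof.
apply/eqP; rewrite eq_le C0_normZ_le/=; have [->|a0] := eqVneq a 0.
  by rewrite normr0 mul0r C0_norm_ge0.
rewrite mulrC -ler_pdivlMr ?normr_gt0// mulrC -normfV.
by rewrite -{1}[x](scalerK a0) C0_normZ_le.
Qed.

Fact C0_norm0_eq0 x : C0_norm x = 0 -> x = 0.
Proof.
move=> x0; apply/C0P => t; apply/eqP; rewrite C0_zeroE -normr_le0 -x0.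
exact: C0_norm_ub.
Qed.

HB.instance Definition _ := Lmodule_isNormed.Build R (C0 h)
  C0_normD C0_normZ C0_norm0_eq0.

Lemma C0_normE (x : C0 h) : `|x| = sup (range (fun t => `|x t|)).
Proof. by []. Qed.

Fact C0_complete (F : set_system (C0 h)) : ProperFilter F -> cauchy F -> cvg F.
Proof.
move=> PF /cauchy_ballP Fc.
pose ev (t : I) (x : C0 h) : R := x t.
have nearF e : 0 < e ->
    \forall x \near F & y \near F, forall t, `|ev t x - ev t y| <= e.
  move=> e0; apply: filterS (Fc e e0) => -[x y] /=.
  rewrite -ball_normE/= => /ltW xy t; apply: le_trans xy.
  exact: (C0_norm_ub (x - y)).
pose f t := lim (ev t @ F).
have Ff t : ev t @ F --> f t.
  apply: cauchy_cvg; apply/cauchy_ballP => e e0.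
  have e20 : 0 < e / 2 by rewrite divr_gt0.
  near_simpl; apply: filterS (nearF _ e20) => -[x y] /= /(_ t) xy.
  rewrite -ball_normE /=; apply: (le_lt_trans xy).
  by rewrite ltr_pdivrMr// ltr_pMr// ltr1n.
have Fu e : 0 < e -> \forall x \near F, forall t, `|ev t x - f t| <= e.
  move=> e0; have /nearP_dep := nearF _ e0.
  apply: filterS => x xF t.
  have xf : (fun y => `|ev t x - ev t y|) @ F --> `|ev t x - f t|.
    by apply: cvg_norm; apply: cvgB; [exact: cvg_cst|exact: Ff].
  by apply: (cvgr_to_le xf); apply: filterS xF.
have cf : continuous f.
  move=> t; apply: (iffRL (@cvgrPdist_le _ R _ (nbhs t) _ f (f t))) => e e0.
  have e30 : 0 < e / 3 by rewrite divr_gt0.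
  have [x xf] := filter_ex (Fu _ e30).
  have xt d : 0 < d -> \forall s \near t, `|x t - x s| <= d.
    move: d; apply: (iffLR (@cvgrPdist_le _ R _ (nbhs t) _ x (x t))).
    exact: C0_cts.
  apply: filterS (xt _ e30) => s xts.
  have -> : f t - f s = (f t - x t) + ((x t - x s) + (x s - f s)) by ring.
  have -> : e = e / 3 + (e / 3 + e / 3) by field.
  apply: (le_trans (ler_normD _ _)).
  apply: lerD; first by rewrite distrC; exact: xf.
  apply: (le_trans (ler_normD _ _)).
  by apply: lerD; [exact: xts|exact: xf].
apply/cvg_ex; exists (MkC0 cf); apply/cvgrPdist_le => e e0.
apply: filterS (Fu _ e0) => x xf; apply: C0_norm_le => t.
by rewrite C0_addE C0_oppE /= distrC; exact: xf.
Qed.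

HB.instance Definition _ := Uniform_isComplete.Build (C0 h) C0_complete.

HB.instance Definition _ := @isMeasurable.Build (sigma_display (@open (C0 h)))
  (C0 h) <<s @open (C0 h)>> (@sigma_algebra0 _ setT _)
  (@sigma_algebraC (C0 h) _) (@sigma_algebra_bigcup _ setT _).

End C0_theory.

(** * Gaussian processes and the Wiener integral *)

Section processes.
Context {d : measure_display} {Omega : measurableType d} {R : realType}.
Variable P : probability Omega R.
Implicit Types (W xi : R -> Omega -> R) (Y : Omega -> R).

(** The degenerate law is treated apart because [normal_prob m 0] is not the
    Dirac mass at [m]. *)
Definition gaussian_rv Y : Prop :=
  measurable_fun setT Y /\
  exists m s : R, 0 <= s /\ forall A : set R, measurable A ->
    P (Y @^-1` A) = (if s == 0 then \d_m A else normal_prob m s A).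

Definition gaussian_process xi : Prop :=
  forall s : seq (R * R),
    gaussian_rv (fun w => \sum_(ct <- s) ct.1 * xi ct.2 w).

(** Mutual independence of the increments over consecutive intervals; taking
    some of the [A i] to be [setT] gives the product rule for subfamilies. *)
Definition independent_increments W : Prop :=
  forall (m : nat) (t : nat -> R) (A : nat -> set R),
    {homo t : i j / (i <= j)%N >-> i <= j} ->
    (forall i, measurable (A i)) ->
    P [set w | forall i : 'I_m, A i (W (t i.+1) w - W (t i) w)] =
    (\prod_(i < m) P [set w | A i (W (t i.+1) w - W (t i) w)%R])%E.

Record wiener_process W : Prop := {
  wiener_measurable : forall t, measurable_fun setT (W t) ;
  wiener_zero : {ae P, forall w, W 0 w = 0} ;
  wiener_continuous : {ae P, forall w, continuous (W ^~ w)} ;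
  wiener_independent : independent_increments W ;
  wiener_increment : forall s t : R, s < t -> forall A : set R, measurable A ->
    P [set w | A (W t w - W s w)] = normal_prob 0 (Num.sqrt (t - s)) A }.

(** A step function is a finite list of weighted intervals ]lo, hi]; its
    Wiener integral is the corresponding combination of increments. *)
Record step := Step {
  height : R ;
  lo : R ;
  hi : R ;
  lo_le_hi : lo <= hi }.

Definition step_fun (phi : seq step) (x : R) : R :=
  \sum_(p <- phi) height p * \1_`]lo p, hi p] x.

Definition step_integral W (phi : seq step) (w : Omega) : R :=
  \sum_(p <- phi) height p * (W (hi p) w - W (lo p) w).

(** [Y] is (a version of) the Wiener integral of [f] over the real line: the
    limit in L2(P) of the integrals of step functions that tend to [f] in L2
    for the Lebesgue measure. By isometry it does not depend, up to a null
    set, on the approximating sequence. *)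
Definition wiener_integral W (f : R -> R) Y : Prop :=
  measurable_fun setT Y /\
  exists phi : nat -> seq step,
    (fun k => \int[lebesgue_measure]_x ((f x - step_fun (phi k) x) ^+ 2)%:E)%E
      @ \oo --> 0%E /\
    (fun k => \int[P]_w ((Y w - step_integral W (phi k) w) ^+ 2)%:E)%E
      @ \oo --> 0%E.

Definition wiener_integral_on W (D : set R) (f : R -> R) Y : Prop :=
  wiener_integral W (fun s => \1_D s * f s) Y.

Record ornstein_uhlenbeck W (theta : R) xi : Prop := {
  ou_continuous : forall w, continuous (xi ^~ w) ;
  ou_gaussian : gaussian_process xi ;
  ou_centered : forall t, ('E_P[xi t] = 0)%E ;
  ou_integral : forall t, wiener_integral_on W `]-oo, t]
    (fun s => expR (- theta * (t - s))) (xi t) }.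

End processes.

(** * Stationary solutions of the autoregressive equation in C([0, h]) *)

Section autoregression.
Context {d : measure_display} {Omega : measurableType d} {R : realType}.
Variable P : probability Omega R.

(** Strict stationarity: the joint laws, on the product sigma-algebra, are
    invariant under time shifts. *)
Definition strictly_stationary {d'} {T : measurableType d'}
    (X : int -> Omega -> T) : Prop :=
  (forall n, measurable_fun setT (X n)) /\
  forall (m : nat) (n : 'I_m -> int) (k : int) (A : set (m.-tuple T)),
    measurable A ->
    P [set w | A [tuple X (n i + k) w | i < m]] =
    P [set w | A [tuple X (n i) w | i < m]].

Context {h : {posnum R}}.

Fact rho_continuous (theta : R) (x : C0 h) :
  continuous (fun t : set_type `[0%R, h%:num] =>
    expR (- theta * set_val t) * x (C0_end h)).
Proof.
pose v (t : set_type `[0%R, h%:num]) : R := - theta * set_val t.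
have cv : continuous v.
  move=> t; apply: (@continuousM _ _ (cst (- theta)) set_val).
    exact: cst_continuous.
  exact: initial_continuous.
move=> t; apply: (@continuousM _ _ (expR \o v) (cst (x (C0_end h)))).
  by apply: continuous_comp; [exact: cv|exact: continuous_expR].
exact: cst_continuous.
Qed.

Definition rho (theta : R) (x : C0 h) : C0 h :=
  MkC0 (@rho_continuous theta x).

Definition innovations (W : R -> Omega -> R) (theta : R)
    (eps : int -> Omega -> C0 h) : Prop :=
  forall (n : int) (t : set_type `[0%R, h%:num]),
    wiener_integral_on P W `](n%:~R * h%:num), (n%:~R * h%:num + set_val t)]
      (fun s => expR (- theta * (n%:~R * h%:num + set_val t - s)))
      (fun w => eps n w t).

Definition ar1_solution (theta : R) (eps X : int -> Omega -> C0 h) : Prop :=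
  {ae P, forall w, forall n, X n w = rho theta (X (n - 1) w) + eps n w}.

(** The series converges to [X n] in the norm of C([0, h]), almost surely and
    in L2. *)
Definition mab_infty (theta : R) (eps X : int -> Omega -> C0 h) : Prop :=
  let S n w := series (fun k : nat => iter k (rho theta) (eps (n - k%:Z) w)) in
  {ae P, forall w, forall n, S n w @ \oo --> X n w} /\
  forall n,
    (fun K => \int[P]_w (`|X n w - S n w K| ^+ 2)%:E)%E @ \oo --> 0%E.

End autoregression.

(* Main.v *)
From HB Require Import structures.
Require Import Defs.
From mathcomp Require Import all_boot all_order all_algebra.
From mathcomp Require Import ring lra.
From mathcomp Require Import all_classical all_reals all_analysis measurable_realfun.

Set Implicit Arguments.
Unset Strict Implicit.
Unset Printing Implicit Defensive.

Import Order.TTheory GRing.Theory Num.Theory.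
Import numFieldNormedType.Exports.

Local Open Scope classical_set_scope.
Local Open Scope ring_scope.

(** The isometry E (I phi)^2 = kappa * int phi^2 for step functions [phi],
    where kappa is the second moment of N(0, 1), makes the Wiener integral
    linear in its integrand and unique up to null sets. Splitting the kernel of
    xi_(nh+t) at time nh then gives the autoregression for each fixed t, hence
    almost surely at all rational t, hence in C([0, h]) by continuity.

    Step integrals are functions of increments of W over consecutive intervals,
    whose joint law does not change when time is shifted; passing to the limit
    in L2, neither do the finite-dimensional laws of xi. They determine the law
    of X because evaluations generate the Borel sigma-algebra of C([0, h]).

    Unfolding the autoregression K times, the remainder of the series for X_n is
    rho^K X_(n-K), and with q = exp (- theta h) < 1 one has
    |rho^(K+1) x| <= q^K |x(h)|. *)

(** * The Wiener isometry *)

(** The remainder of the series starts from X_(n-K), a point that moves with K, so the contraction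
    has to be weighed against the size of X_(n-K)(h). In L2 this size is constant, by stationarity
    and finiteness of the second moment. Almost surely the sequence may be unbounded, but its
    squares grow at most like q^(-K), which leaves a factor q^K to spare in the squared remainder. A
    competing solution in the uniqueness claim comes with no moment bound; there the tightness of
    its law at the point h takes over, and the difference of two solutions is shown to vanish in
    probability. Passing laws to the limit meets another obstacle: under L2 convergence distribution
    functions may fail to converge at atoms. They are therefore compared by inequalities with a
    slack in the thresholds, which continuity from above removes. What the argument asks of kappa is
    finiteness: it makes the integral continuous from L2 of the line to L2(P). *)

Section normal_second_moment.
Context {R : realType}.
Local Notation mu := (@lebesgue_measure R).

(** Change of variables brings in the Radon-Nikodym derivative of [normal_prob m s]. It equals the
    Gaussian density almost everywhere because both have the same integral over every measurable
    set. *)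
Lemma ge0_integral_normal_prob (m s : R) (f : R -> \bar R) :
  measurable_fun [set: R] f -> (forall x, 0 <= f x)%E ->
  (\int[normal_prob m s]_x f x = \int[mu]_x (f x * (normal_pdf m s x)%:E))%E.
Proof.
move=> mf f0.
have Nmu := normal_prob_dominates m s.
rewrite -(Radon_Nikodym_SigmaFinite.change_of_variables Nmu)//.
have mg := measurable_int _ (Radon_Nikodym_SigmaFinite.f_integrable Nmu).
apply: ae_eq_integral => //.
- exact: emeasurable_funM.
- apply: emeasurable_funM => //; apply/measurable_EFinP.
  exact: measurable_normal_pdf.
- apply: ae_eqe_mul2l; apply: integral_ae_eq => //.
  + exact: Radon_Nikodym_SigmaFinite.f_integrable.
  + by apply/measurable_EFinP; exact: measurable_normal_pdf.
  + by move=> A _ mA; rewrite -Radon_Nikodym_SigmaFinite.f_integral.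
Qed.

Definition gauss_sqr : \bar R :=
  (\int[mu]_x (x ^+ 2 * normal_pdf 0 1 x)%:E)%E.

(** With u = x^2/4, the bound 1 + u <= exp u gives x^2 exp(-x^2/2) <= 4 exp(-x^2/4), and the right
    side is a multiple of the density of N(0, 2). The constant [c] is 4 times the ratio of the two
    normalizations. *)
Lemma gauss_sqr_fin_num : gauss_sqr \is a fin_num.
Proof.
have s2 : Num.sqrt 2 != 0 :> R by rewrite gt_eqF// sqrtr_gt0.
pose c : R := 4 * normal_peak 1 / normal_peak (Num.sqrt 2).
have c0 : 0 <= c by rewrite !mulr_ge0// ?invr_ge0 ?normal_peak_ge0.
rewrite ge0_fin_numE; last first.
  apply: integral_ge0 => x _; rewrite lee_fin mulr_ge0 ?sqr_ge0//.
  exact: normal_pdf_ge0.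
apply: (@le_lt_trans _ _
    (\int[mu]_x (c%:E * (normal_pdf 0 (Num.sqrt 2) x)%:E))%E).
  apply: ge0_le_integral => //=.
  - move=> x _; rewrite lee_fin mulr_ge0 ?sqr_ge0//; exact: normal_pdf_ge0.
  - apply/measurable_EFinP/measurable_funM => //.
    exact: measurable_normal_pdf.
  - apply: emeasurable_funM => //; apply/measurable_EFinP.
    exact: measurable_normal_pdf.
  - move=> x _; rewrite -EFinM lee_fin !normal_pdfE// /c /normal_fun.
    rewrite !subr0 !expr1n sqr_sqrtr// mulrCA -!mulrA.
    rewrite (mulrCA 4) ler_wpM2l ?normal_peak_ge0//.
    rewrite mulKf ?gt_eqF ?normal_peak_gt0//.
    have -> : - x ^+ 2 / 2 = - (x ^+ 2 / 4) + - (x ^+ 2 / 4) by field.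
    have -> : - x ^+ 2 / (2 *+ 2) = - (x ^+ 2 / 4) by field.
    rewrite expRD !mulrA ler_wpM2r ?expR_ge0// -expr2 expRN.
    rewrite ler_pdivrMr ?expR_gt0//; have := expR_ge1Dx (x ^+ 2 / 4).
    by move: (expR _) => e; lra.
rewrite ge0_integralZl//=.
- by rewrite integral_normal_pdf mule1 ltry.
- by apply/measurable_EFinP; exact: measurable_normal_pdf.
- by move=> x _; rewrite lee_fin normal_pdf_ge0.
Qed.

Lemma ge0_integral_dilation (s : R) (G : R -> R) : 0 < s -> continuous G ->
  (forall x, 0 <= G x) ->
  (\int[mu]_x (G x)%:E = \int[mu]_x (G (s * x) * s)%:E)%E.
Proof.
move=> s0 cG G0; pose F (x : R) : R := s * x.
have dF x : derivable F x 1 by exact: derivableM.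
have F'E : F^`()%classic = cst s.
  apply/funext => x; rewrite derive1E deriveM// derive_id derive_cst.
  by rewrite scaler0 addr0 /GRing.scale /= mulr1.
rewrite (@increasing_ge0_integration_by_substitutionT _ F) ?F'E//.
- by move=> x y xy; rewrite /F ltr_pM2l.
- by move=> x; exact: cvg_cst.
- exact: is_cvg_cst.
- exact: is_cvg_cst.
- exact: gt0_cvgMrNy.
- exact: gt0_cvgMry.
Qed.

Lemma sqr_normal_pdf_dilation (s x : R) : 0 < s ->
  (s * x) ^+ 2 * normal_pdf 0 s (s * x) * s =
  s ^+ 2 * (x ^+ 2 * normal_pdf 0 1 x).
Proof.
move=> s0; rewrite !normal_pdfE ?gt_eqF// /normal_fun /normal_peak.
rewrite !subr0 expr1n mul1r -mulrnAr sqrtrM ?sqr_ge0// sqrtr_sqr.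
rewrite gtr0_norm// invfM.
have -> : - (s * x) ^+ 2 / (s ^+ 2 *+ 2) = - x ^+ 2 / (1 *+ 2).
  by field; rewrite gt_eqF.
by move: (Num.sqrt _)^-1 (expR _) => q e; field; rewrite gt_eqF.
Qed.

Lemma normal_prob_sqr (s : R) : 0 < s ->
  (\int[normal_prob 0 s]_x (x ^+ 2)%:E = (s ^+ 2 * fine gauss_sqr)%:E)%E.
Proof.
move=> s0; rewrite ge0_integral_normal_prob//; last 2 first.
  exact/measurable_EFinP.
  by move=> x; rewrite lee_fin sqr_ge0.
under eq_integral do rewrite -EFinM.
have cG : continuous (fun x : R => x ^+ 2 * normal_pdf 0 s x).
  move=> x; apply: cvgM; first exact: exprn_continuous.
  by apply: continuous_normal_pdf; rewrite gt_eqF.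
rewrite (ge0_integral_dilation s0)//; last first.
  by move=> x; rewrite mulr_ge0 ?sqr_ge0// normal_pdf_ge0.
under eq_integral.
  move=> x _; rewrite sqr_normal_pdf_dilation//.
  rewrite EFinM; over.
rewrite ge0_integralZl//=.
- by rewrite [RHS]EFinM fineK// gauss_sqr_fin_num.
- apply/measurable_EFinP/measurable_funM => //; exact: measurable_normal_pdf.
- by move=> x _; rewrite lee_fin mulr_ge0 ?sqr_ge0// normal_pdf_ge0.
- by rewrite lee_fin sqr_ge0.
Qed.

End normal_second_moment.
Section isometry.
Context {R : realType}.
Local Notation mu := (@lebesgue_measure R).

(** Expanding the square reduces a second moment to the Gram matrix [G]. Both sides of the isometry
    are computed in this way: indicators under Lebesgue measure, increments under [P]. *)
Lemma integral_sqr_sum d (T : measurableType d)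
    (m : {measure set T -> \bar R}) (I : Type) (r : seq I) (c : I -> R)
    (F : I -> T -> R) (G : I -> I -> R) :
  (forall i j, m.-integrable setT (fun x => (F i x * F j x)%:E)) ->
  (forall i j, \int[m]_x (F i x * F j x)%:E = (G i j)%:E)%E ->
  (\int[m]_x ((\sum_(i <- r) c i * F i x) ^+ 2)%:E =
   (\sum_(i <- r) \sum_(j <- r) c i * c j * G i j)%:E)%E.
Proof.
move=> iF FG.
transitivity (\int[m]_x (\sum_(i <- r) \sum_(j <- r)
    ((c i * c j)%:E * (F i x * F j x)%:E)))%E.
  apply: eq_integral => x _; rewrite expr2 mulr_suml -sumEFin.
  apply: eq_bigr => i _; rewrite mulr_sumr -sumEFin; apply: eq_bigr => j _.
  by rewrite -EFinM mulrACA.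
have iZ i j : m.-integrable setT
    (fun x => ((c i * c j)%:E * (F i x * F j x)%:E)%E) by exact: integrableZl.
rewrite integral_sum//; last by move=> i; exact: integrable_sum.
rewrite -sumEFin; apply: eq_bigr => i _.
rewrite integral_sum// -sumEFin; apply: eq_bigr => j _.
by rewrite integralZl// FG.
Qed.

(** The length of the intersection of the two intervals, written by polarization in terms of
    distances between endpoints. This is the form in which the covariance of two increments arises
    from E (W_t - W_s)^2 = kappa |t - s|. *)
Definition overlap (p q : step) : R :=
  (`|hi p - lo q| + `|lo p - hi q| - `|hi p - hi q| - `|lo p - lo q|) / 2.

Lemma integral_indic_overlap (p q : step) :
  (\int[mu]_x (\1_`]lo p, hi p] x * \1_`]lo q, hi q] x)%:E = (overlap p q)%:E)%E.
Proof.
transitivity (\int[mu]_x (\1_(`]lo p, hi p] `&` `]lo q, hi q]) x)%:E)%E.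
  by apply: eq_integral => x _; rewrite indicI.
rewrite integral_indic//; last exact: measurableI.
rewrite setIT -set_itvI; apply: (etrans (lebesgue_measure_itv _)) => /=.
case: p q => hp s t st [hq u v uv]; rewrite /overlap/=.
rewrite joinEtotal meetEtotal lte_fin.
(* Each absolute value becomes a signed linear expression, so that every relative position of the
   four endpoints is settled by [lra]. *)
have normE (a : R) : 0 <= a /\ `|a| = a \/ a <= 0 /\ `|a| = - a.
  have [a0|/ltW a0] := leP 0 a; [left|right].
    by rewrite ger0_norm.
  by rewrite ler0_norm.
case: ifPn => [|/negbTE]; [rewrite -EFinB|rewrite ltNge => /negbFE];
  move=> h; congr EFin; move: h.
all: have := normE (t - u); have := normE (s - v); have := normE (t - v);
  have := normE (s - u).
all: case: (leP s u) => su; case: (leP t v) => tv.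
all: case=> -[? ->]; case=> -[? ->]; case=> -[? ->]; case=> -[? ->]; lra.
Qed.

Lemma integral_step_fun_sqr (phi : seq step) :
  (\int[mu]_x ((step_fun phi x) ^+ 2)%:E =
   (\sum_(p <- phi) \sum_(q <- phi) height p * height q * overlap p q)%:E)%E.
Proof.
apply: integral_sqr_sum; last exact: integral_indic_overlap.
move=> p q; apply/integrableP; split.
  by apply/measurable_EFinP; apply: measurable_funM.
under eq_integral do rewrite gee0_abs ?lee_fin ?mulr_ge0//.
by rewrite integral_indic_overlap ltry.
Qed.

End isometry.

Section wiener_isometry.
Context {d : measure_display} {Omega : measurableType d} {R : realType}.
Variables (P : probability Omega R) (W : R -> Omega -> R).
Hypothesis W_wiener : wiener_process P W.

Lemma measurable_increment s t : measurable_fun setT (fun w => W t w - W s w).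
Proof. by apply: measurable_funB; exact: (wiener_measurable W_wiener). Qed.

Local Notation mu := (@lebesgue_measure R).
Local Notation kappa := (fine (@gauss_sqr R)).

Lemma integral_increment_sqr s t :
  (\int[P]_w ((W t w - W s w) ^+ 2)%:E = (kappa * `|t - s|)%:E)%E.
Proof.
wlog st : s t / s < t.
  move=> h; have [/h//|/h|->] := ltgtP s t; last first.
    under eq_integral do rewrite subrr expr0n/=.
    by rewrite integral0 subrr normr0 mulr0.
  by rewrite distrC; under eq_integral do rewrite -sqrrN opprB.
have mD := measurable_increment s t.
have mX : @measurable_fun _ _ Omega (measurableTypeR R) setT
  (fun w => W t w - W s w) := mD.
pose mfX := isMeasurableFun.Build _ _ _ _ _ mX.
pose X : {mfun Omega >-> measurableTypeR R} := HB.pack (fun w => W t w - W s w) mfX.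
transitivity (\int[pushforward P X]_x (x ^+ 2)%:E)%E.
  rewrite ge0_integral_pushforward//.
  - exact/measurable_EFinP.
  - by move=> x _; rewrite lee_fin sqr_ge0.
transitivity (\int[normal_prob 0 (Num.sqrt (t - s))]_x (x ^+ 2)%:E)%E.
  by apply: eq_measure_integral => A mA _; exact: (wiener_increment W_wiener).
rewrite normal_prob_sqr ?sqrtr_gt0 ?subr_gt0//.
by rewrite sqr_sqrtr ?subr_ge0 ?(ltW st)// mulrC gtr0_norm ?subr_gt0.
Qed.

Lemma integrable_increment_sqr s t :
  P.-integrable setT (fun w => ((W t w - W s w) ^+ 2)%:E).
Proof.
apply/integrableP; split.
  apply/measurable_EFinP; apply: measurable_funX; exact: measurable_increment.
under eq_integral do rewrite gee0_abs ?lee_fin ?sqr_ge0//.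
by rewrite integral_increment_sqr ltry.
Qed.

(* By polarization the covariance of two increments needs only the second
   moments of increments, not their independence. *)
Lemma increment_mulE (p q : step) w :
  ((W (hi p) w - W (lo p) w) * (W (hi q) w - W (lo q) w))%:E =
  (2^-1%:E * (((W (hi p) w - W (lo q) w) ^+ 2)%:E +
              ((W (lo p) w - W (hi q) w) ^+ 2)%:E -
              ((W (hi p) w - W (hi q) w) ^+ 2)%:E -
              ((W (lo p) w - W (lo q) w) ^+ 2)%:E))%E.
Proof. by rewrite -!EFinN -!EFinD -EFinM; congr EFin; field. Qed.

Lemma integrable_increment_mul (p q : step) : P.-integrable setT (fun w =>
  ((W (hi p) w - W (lo p) w) * (W (hi q) w - W (lo q) w))%:E).
Proof.
under eq_fun do rewrite increment_mulE.
apply: integrableZl => //; apply: integrableB => //; last first.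
  exact: integrable_increment_sqr.
apply: integrableB => //; last exact: integrable_increment_sqr.
by apply: integrableD => //; exact: integrable_increment_sqr.
Qed.

Lemma integral_increment_mul (p q : step) :
  (\int[P]_w ((W (hi p) w - W (lo p) w) * (W (hi q) w - W (lo q) w))%:E =
   (kappa * overlap p q)%:E)%E.
Proof.
have iW := integrable_increment_sqr.
under eq_integral do rewrite increment_mulE.
rewrite integralZl//; last first.
  by apply: integrableB => //; apply: integrableB => //; exact: integrableD.
rewrite integralB//; last by apply: integrableB => //; exact: integrableD.
rewrite integralB//; last exact: integrableD.
rewrite integralD// !integral_increment_sqr -!EFinN -!EFinD -EFinM.
by congr EFin; rewrite /overlap; field.
Qed.

(** Both sides are quadratic forms in the heights, and the Gram matrix of the increments is kappa
    times that of the indicators. *)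
Lemma wiener_isometry (phi : seq step) :
  (\int[P]_w ((step_integral W phi w) ^+ 2)%:E =
   kappa%:E * \int[mu]_x ((step_fun phi x) ^+ 2)%:E)%E.
Proof.
rewrite (integral_sqr_sum _ _ integrable_increment_mul integral_increment_mul).
rewrite integral_step_fun_sqr -EFinM; congr EFin; rewrite mulr_sumr.
apply: eq_bigr => p _; rewrite mulr_sumr; apply: eq_bigr => q _; ring.
Qed.

End wiener_isometry.

(** * Shift invariance of the law of step integrals *)

Section generated_laws.

Lemma measurable_forall_in d (T : measurableType d) (I : eqType) (l : seq I)
    (A : I -> set T) : (forall i, i \in l -> measurable (A i)) ->
  measurable [set x | forall i, i \in l -> A i x].
Proof.
elim: l => [_|j l IH mA].
  by rewrite [X in measurable X](_ : _ = setT)//; apply/seteqP; split.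
rewrite [X in measurable X](_ : _ =
    A j `&` [set x | forall i, i \in l -> A i x]); last first.
  apply/seteqP; split=> [x /= Ax|x /= [Ajx Ax] i].
    by split=> [|i il]; apply: Ax; rewrite inE ?eqxx// il orbT.
  by rewrite inE => /predU1P[->//|]; exact: Ax.
apply: measurableI; first by apply: mA; rewrite inE eqxx.
by apply: IH => i il; apply: mA; rewrite inE il orbT.
Qed.

Lemma measurable_le {R : realType} d (T : measurableType d) (f : T -> R) c :
  measurable_fun setT f -> measurable [set x | f x <= c].
Proof.
move=> mf; rewrite (_ : [set x | f x <= c] = f @^-1` `]-oo, c]).
  by rewrite -[X in measurable X]setTI; apply: mf.
by apply/seteqP; split=> x /=; rewrite in_itv.
Qed.

Lemma measurable_ge {R : realType} d (T : measurableType d) (f : T -> R) c :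
  measurable_fun setT f -> measurable [set x | c <= f x].
Proof.
move=> mf; rewrite (_ : [set x | c <= f x] = f @^-1` `[c, +oo[).
  by rewrite -[X in measurable X]setTI; apply: mf.
by apply/seteqP; split=> x /=; rewrite in_itv/= andbT.
Qed.

(** Uniqueness of measures: the two image measures are finite and agree on a generating pi-system.
    Since [setT] belongs to [G], the constant sequence serves as exhausting cover. *)
Lemma eq_law {R : realType} d d' (Omega : measurableType d)
    (T : measurableType d') (P : probability Omega R) (X Y : Omega -> T)
    (G : set (set T)) :
  measurable = <<s G>> -> setI_closed G -> G setT ->
  measurable_fun setT X -> measurable_fun setT Y ->
  (forall A, G A -> P (X @^-1` A) = P (Y @^-1` A)) ->
  forall A, measurable A -> P (X @^-1` A) = P (Y @^-1` A).
Proof.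
move=> mG GI GT mX mY XY A mA.
pose mfX := isMeasurableFun.Build _ _ _ _ _ mX.
pose mfY := isMeasurableFun.Build _ _ _ _ _ mY.
pose X' : {mfun Omega >-> T} := HB.pack X mfX.
pose Y' : {mfun Omega >-> T} := HB.pack Y mfY.
apply: (measure_unique G (fun=> setT) mG GI _ _
  (pushforward P X') (pushforward P Y')) => //.
- by rewrite bigcup_const//; exists 0%N.
- by move=> _; exact: (le_lt_trans (probability_le1 P measurableT) (ltry 1)).
Qed.

Lemma measurable_tupleE d (T : measurableType d) m
    (G : set (set (m.-tuple T))) : G `<=` measurable ->
  (forall (i : 'I_m) C, measurable C -> <<s G>> [set u | C (tnth u i)]) ->
  @measurable _ (m.-tuple T) = <<s G>>.
Proof.
move=> Gm mG; apply/seteqP; split.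
  apply: smallest_sub; first exact: smallest_sigma_algebra.
  move=> A; rewrite -bigcup_seq => -[i _ [C mC <-]].
  by rewrite setTI; exact: mG.
by apply: smallest_sub => //; exact: sigma_algebra_measurable.
Qed.

(** The sides form a sequence over [nat], to match the families of sets in
    [independent_increments]. *)
Definition rectangle d (T : measurableType d) m : set (set (m.-tuple T)) :=
  [set B | exists F : nat -> set T, (forall i, measurable (F i)) /\
    B = [set u | forall i : 'I_m, F i (tnth u i)]].

Lemma rectangle_measurable d (T : measurableType d) m :
  @rectangle d T m `<=` measurable.
Proof.
move=> _ [F [mF ->]].
rewrite [X in measurable X](_ : _ =
    [set u | forall i, i \in enum 'I_m -> F i (tnth u i)]); last first.
  by apply/seteqP; split=> u /= Fu i *; apply: Fu; rewrite ?mem_enum.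
apply: measurable_forall_in => i _.
by rewrite -[X in measurable X]setTI; apply: measurable_tnth.
Qed.

Lemma rectangle_setI_closed d (T : measurableType d) m :
  setI_closed (@rectangle d T m).
Proof.
move=> _ _ [F [mF ->]] [F' [mF' ->]].
exists (fun i => F i `&` F' i); split; first by move=> i; exact: measurableI.
apply/seteqP; split=> [u /= [Fu F'u] i|u /= FF'u]; first by split.
by split=> i; case: (FF'u i).
Qed.

Lemma measurable_rectangleE d (T : measurableType d) m :
  @measurable _ (m.-tuple T) = <<s @rectangle d T m>>.
Proof.
apply: measurable_tupleE; first exact: rectangle_measurable.
move=> i C mC; apply: sub_sigma_algebra.
exists (fun j => if j == i :> nat then C else setT); split.
  by move=> j; case: ifP.
apply/seteqP; split=> u /= => [Cu j|/(_ i)]; last by rewrite eqxx.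
by case: ifP => // /eqP/val_inj ->.
Qed.

End generated_laws.

Section shift_invariance.
Context {d : measure_display} {Omega : measurableType d} {R : realType}.
Variables (P : probability Omega R) (W : R -> Omega -> R).
Hypothesis W_wiener : wiener_process P W.

Lemma increment_law_shift (s t a : R) (A : set R) : s <= t -> measurable A ->
  P [set w | A (W (t + a) w - W (s + a) w)] = P [set w | A (W t w - W s w)].
Proof.
rewrite le_eqVlt => /predU1P[->|st] mA; last first.
  have sta : s + a < t + a by rewrite ltrD2r.
  have -> := wiener_increment W_wiener sta mA.
  have -> := wiener_increment W_wiener st mA.
  by rewrite opprD addrACA subrr addr0.
by congr (P _); apply/seteqP; split=> w /=; rewrite !subrr.
Qed.

(** On a rectangle, independence turns the probability into a product over the increments, and each
    factor keeps its value under the shift. Rectangles form a generating pi-system, so [eq_law]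
    concludes. *)
Lemma increments_law_shift m (t : nat -> R) (a : R) (A : set (m.-tuple R)) :
  {homo t : i j / (i <= j)%N >-> i <= j} -> measurable A ->
  P [set w | A [tuple W (t i.+1 + a) w - W (t i + a) w | i < m]] =
  P [set w | A [tuple W (t i.+1) w - W (t i) w | i < m]].
Proof.
move=> homo_t mA.
apply: (@eq_law R d _ Omega (m.-tuple R) P
  (fun w => [tuple W (t i.+1 + a) w - W (t i + a) w | i < m])
  (fun w => [tuple W (t i.+1) w - W (t i) w | i < m])
  _ (measurable_rectangleE R m)) => //.
- exact: rectangle_setI_closed.
- by exists (fun=> setT); split=> //; apply/seteqP; split.
- apply/measurable_fun_tnthP => i.
  apply: (eq_measurable_fun (fun w => W (t i.+1 + a) w - W (t i + a) w)).
    by move=> w _ /=; rewrite tnth_mktuple.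
  exact: (measurable_increment W_wiener).
- apply/measurable_fun_tnthP => i.
  apply: (eq_measurable_fun (fun w => W (t i.+1) w - W (t i) w)).
    by move=> w _ /=; rewrite tnth_mktuple.
  exact: (measurable_increment W_wiener).
move=> _ [F [mF ->]]; have /= indep := wiener_independent W_wiener.
transitivity (P [set w | forall i : 'I_m,
    F i (W (t i.+1 + a) w - W (t i + a) w)]).
  congr (P _); apply/seteqP.
  by split=> w /= Fw i; have := Fw i; rewrite tnth_mktuple.
rewrite (indep m (fun i => t i + a))//; last first.
  by move=> i j ij; rewrite lerD2r; exact: homo_t.
under eq_bigr do rewrite increment_law_shift ?homo_t//.
rewrite -(indep m t F)//; congr (P _); apply/seteqP.
by split=> w /= Fw i; have := Fw i; rewrite tnth_mktuple.
Qed.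

Lemma step_shift_subproof a (p : @step R) : lo p + a <= hi p + a.
Proof. by rewrite lerD2r lo_le_hi. Qed.

Definition step_shift a (p : step) : step :=
  Step (height p) (step_shift_subproof a p).

Lemma measurable_step_integral (phi : seq step) :
  measurable_fun setT (step_integral W phi).
Proof.
apply: measurable_sum => p; apply: measurable_funM => //.
exact: (measurable_increment W_wiener).
Qed.

(** The sorted endpoints [pts] of all the step functions form one common partition. Over it every
    step integral is the same measurable function of the vector [D] of increments, whatever the
    shift, so the claim reduces to the law of that vector. *)
Lemma step_integral_law_shift (I : eqType) (l : seq I) (phi : I -> seq step)
    (c : I -> R) a :
  P [set w | forall i, i \in l ->
       step_integral W (map (step_shift a) (phi i)) w <= c i] =
  P [set w | forall i, i \in l -> step_integral W (phi i) w <= c i].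
Proof.
pose pts := sort <=%R (flatten
  [seq ([seq lo p | p <- phi i] ++ [seq hi p | p <- phi i]) | i <- l]).
(* The default value [last 0 pts] makes [t] constant past the end of the list, hence monotone on all
   of [nat]. *)
pose m := size pts; pose t i := nth (last 0 pts) pts i.
have homo_t : {homo t : i j / (i <= j)%N >-> i <= j}.
  move=> i j ij; rewrite /t; have [jm|mj] := ltnP j m.
    apply: (sorted_leq_nth le_trans) => //.
    - exact: sort_le_sorted.
    - by rewrite inE (leq_ltn_trans ij).
  rewrite [leRHS]nth_default//; have [im|mi] := ltnP i m; last first.
    by rewrite nth_default.
  rewrite [leRHS](_ : _ = nth (last 0 pts) pts m.-1); last first.
    by rewrite (set_nth_default 0) ?nth_last// prednK// (leq_ltn_trans _ im).
  apply: (sorted_leq_nth le_trans) => //.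
  - exact: sort_le_sorted.
  - by rewrite inE prednK// (leq_ltn_trans _ im).
  - by rewrite -ltnS prednK// (leq_ltn_trans _ im).
pose D a' w : m.-tuple R :=
  [tuple W (t i.+1 + a') w - W (t i + a') w | i < m].
(* The increments that precede the point [x] telescope to the increment of W from the smallest
   endpoint to [x]; the base point cancels in differences. *)
pose S x (u : m.-tuple R) := \sum_(i < m | (i < index x pts)%N) tnth u i.
have DE a' w x : x \in pts -> S x (D a' w) = W (x + a') w - W (t 0 + a') w.
  move=> xpts; have tx : t (index x pts) = x by exact: nth_index.
  transitivity (W (t (index x pts) + a') w - W (t 0 + a') w); last by rewrite tx.
  rewrite /S; apply: (etrans _ (@telescope_sumr _ 0 (index x pts)
    (fun i => W (t i + a') w) (leq0n _))).
  rewrite big_mkord (big_ord_widen m (fun i => W (t i.+1 + a') w - W (t i + a') w)).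
    by apply: eq_bigr => i _; rewrite tnth_mktuple.
  by rewrite index_size.
pose L i u : R := \sum_(p <- phi i) height p * (S (hi p) u - S (lo p) u).
have LE a' s w : {subset [seq lo p | p <- s] ++ [seq hi p | p <- s] <= pts} ->
    step_integral W (map (step_shift a') s) w =
    \sum_(p <- s) height p * (S (hi p) (D a' w) - S (lo p) (D a' w)).
  rewrite /step_integral big_map; elim: s => [|p s IH] sub.
    by rewrite !big_nil.
  rewrite !big_cons IH; last first.
    move=> x; rewrite mem_cat => /orP[xs|xs]; apply: sub.
      by rewrite mem_cat/= inE xs orbT.
    by rewrite mem_cat/= !inE xs !orbT.
  rewrite !DE; last 2 first.
  - by apply: sub; rewrite mem_cat/= !inE eqxx ?orbT.
  - by apply: sub; rewrite mem_cat/= !inE eqxx ?orbT.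
  by congr (_ + _) => /=; ring.
have pts_i i : i \in l -> {subset
    [seq lo p | p <- phi i] ++ [seq hi p | p <- phi i] <= pts}.
  move=> il x xi; rewrite mem_sort; apply/flattenP.
  exists ([seq lo p | p <- phi i] ++ [seq hi p | p <- phi i]) => //.
  by apply/mapP; exists i.
pose A := [set u | forall i, i \in l -> L i u <= c i].
have AE a' : [set w | forall i, i \in l ->
    step_integral W (map (step_shift a') (phi i)) w <= c i] =
    [set w | A (D a' w)].
  apply/seteqP; split=> w /= Aw i il; have := Aw i il.
    by rewrite LE//; exact: pts_i.
  by rewrite LE//; exact: pts_i.
have mS x : measurable_fun setT (S x).
  rewrite /S; under eq_fun do rewrite big_mkcond/=.
  apply: measurable_sum => j; case: (_ < _)%N => //; exact: measurable_tnth.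
rewrite AE (@increments_law_shift m t a A homo_t); last first.
  apply: measurable_forall_in => i _; apply: measurable_le.
  apply: measurable_sum => p; apply: measurable_funM => //.
  by apply: measurable_funB; exact: mS.
transitivity (P [set w | A (D 0 w)]).
  have D0 w : [tuple W (t i.+1) w - W (t i) w | i < m] = D 0 w.
    by apply: eq_mktuple => i; rewrite !addr0.
  by congr (P _); apply/seteqP; split=> w /=; rewrite D0.
rewrite -AE; congr (P _); apply/seteqP.
have E i w : step_integral W (map (step_shift 0) (phi i)) w =
    step_integral W (phi i) w.
  by rewrite /step_integral big_map; apply: eq_bigr => p _ /=; rewrite !addr0.
by split=> w /= Aw i il; have := Aw i il; rewrite E.
Qed.

End shift_invariance.

(** * Wiener integrals as limits in L2 *)

Section translation.
Context {R : realType}.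
Local Notation mu := (@lebesgue_measure R).

Lemma ge0_integral_translation (a : R) (f : R -> \bar R) :
  measurable_fun [set: R] f -> (forall x, 0 <= f x)%E ->
  (\int[mu]_x f (x - a)%R = \int[mu]_x f x)%E.
Proof.
move=> mf f0.
have mT : @measurable_fun _ _ (measurableTypeR R) (measurableTypeR R) setT
  (fun x => x - a) by exact: measurable_funB.
pose mfT := isMeasurableFun.Build _ _ _ _ _ mT.
pose T : {mfun measurableTypeR R >-> measurableTypeR R} :=
  HB.pack (fun x : measurableTypeR R => x - a) mfT.
transitivity (\int[pushforward mu T]_x f x)%E.
  by rewrite ge0_integral_pushforward// => x _; exact: f0.
apply: eq_measure_integral => A mA _; apply/esym.
apply: lebesgue_measure_unique => //= _ [[u v]] _ <-.
rewrite /pushforward (_ : _ @^-1` _ = [set` `]u + a, v + a]]); last first.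
  by apply/seteqP; split=> x /=; rewrite !in_itv/= ltrBrDr lerBlDr.
rewrite !lebesgue_measure_itv/= !lte_fin ltrD2r; case: ifP => // _.
by rewrite -!EFinB; congr EFin; ring.
Qed.

End translation.

Section L2_convergence.
Context {d : measure_display} {T : measurableType d} {R : realType}.
Variable m : {measure set T -> \bar R}.

(** Right integrand minus left integrand is (a u - b v)^2. Integrals of nonnegative functions always
    exist, so the bound also covers infinite values. *)
Lemma integral_sqr_lin_le (a b : R) (u v : T -> R) :
  measurable_fun setT u -> measurable_fun setT v ->
  (\int[m]_x ((a * u x + b * v x) ^+ 2)%:E <=
   (2 * a ^+ 2)%:E * \int[m]_x ((u x) ^+ 2)%:E +
   (2 * b ^+ 2)%:E * \int[m]_x ((v x) ^+ 2)%:E)%E.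
Proof.
move=> mu mv.
have c0 (c : R) : 0 <= 2 * c ^+ 2 by rewrite mulr_ge0// sqr_ge0.
have mX (w : T -> R) : measurable_fun setT w ->
    measurable_fun setT (fun x => ((w x) ^+ 2)%:E).
  by move=> mw; apply/measurable_EFinP; exact: measurable_funX.
rewrite -!ge0_integralZl//; try by [rewrite lee_fin|exact: mX|
  move=> x _; rewrite lee_fin sqr_ge0].
rewrite -ge0_integralD//; last 4 first.
- by move=> x _; rewrite -EFinM lee_fin mulr_ge0// sqr_ge0.
- by apply: emeasurable_funM => //; exact: mX.
- by move=> x _; rewrite -EFinM lee_fin mulr_ge0// sqr_ge0.
- by apply: emeasurable_funM => //; exact: mX.
apply: ge0_le_integral => //.
- by move=> x _; rewrite lee_fin sqr_ge0.
- by apply: mX; apply: measurable_funD; exact: measurable_funM.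
- by apply: emeasurable_funD; apply: emeasurable_funM => //; exact: mX.
move=> x _; rewrite -!EFinM -EFinD lee_fin -subr_ge0.
rewrite (_ : _ - _ = (a * u x - b * v x) ^+ 2) ?sqr_ge0//; ring.
Qed.

Lemma cvg_sqr_lin (a b : R) (u v z : nat -> T -> R) :
  (forall k x, z k x = a * u k x + b * v k x) ->
  (forall k, measurable_fun setT (u k)) ->
  (forall k, measurable_fun setT (v k)) ->
  (fun k => \int[m]_x ((u k x) ^+ 2)%:E)%E @ \oo --> 0%E ->
  (fun k => \int[m]_x ((v k x) ^+ 2)%:E)%E @ \oo --> 0%E ->
  (fun k => \int[m]_x ((z k x) ^+ 2)%:E)%E @ \oo --> 0%E.
Proof.
move=> zE mu mv cu cv.
under eq_fun do under eq_integral do rewrite zE.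
have bound : (fun k => (2 * a ^+ 2)%:E * \int[m]_x ((u k x) ^+ 2)%:E +
    (2 * b ^+ 2)%:E * \int[m]_x ((v k x) ^+ 2)%:E)%E @ \oo --> 0%E.
  rewrite -[X in _ --> X]adde0; apply: cvgeD => //.
    by rewrite -(mule0 (2 * a ^+ 2)%:E); exact: cvgeZl.
  by rewrite -(mule0 (2 * b ^+ 2)%:E); exact: cvgeZl.
apply: (squeeze_cvge _ (cvg_cst 0%E) bound).
apply: nearW => k; apply/andP; split; last exact: integral_sqr_lin_le.
by apply: integral_ge0 => x _; rewrite lee_fin sqr_ge0.
Qed.

Lemma integral_sqr_eq0 (u : T -> R) : measurable_fun setT u ->
  (\int[m]_x ((u x) ^+ 2)%:E = 0)%E -> {ae m, forall x, u x = 0}.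
Proof.
move=> mu u0.
have [|+ _] := @ae_eq_integral_abs _ _ _ m setT measurableT
  (fun x => ((u x) ^+ 2)%:E).
  by apply/measurable_EFinP; exact: measurable_funX.
under eq_integral do rewrite gee0_abs ?lee_fin ?sqr_ge0//.
move=> /(_ u0); apply: filterS => x /= /(_ I) [] /eqP.
by rewrite sqrf_eq0 => /eqP.
Qed.

End L2_convergence.

Section wiener_integral_theory.
Context {d : measure_display} {Omega : measurableType d} {R : realType}.
Variables (P : probability Omega R) (W : R -> Omega -> R).
Hypothesis W_wiener : wiener_process P W.
Local Notation mu := (@lebesgue_measure R).

Definition step_scale (a : R) (p : step) : step :=
  Step (a * height p) (lo_le_hi p).

(** Intervals in a list may overlap, so concatenation represents the sum. *)
Definition step_lin (a b : R) (phi psi : seq step) : seq step :=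
  map (step_scale a) phi ++ map (step_scale b) psi.

Lemma step_fun_lin a b phi psi x :
  step_fun (step_lin a b phi psi) x = a * step_fun phi x + b * step_fun psi x.
Proof.
rewrite /step_fun big_cat !big_map !mulr_sumr.
by congr (_ + _); apply: eq_bigr => p _; rewrite mulrA.
Qed.

Lemma step_integral_lin a b phi psi w : step_integral W (step_lin a b phi psi) w =
  a * step_integral W phi w + b * step_integral W psi w.
Proof.
rewrite /step_integral big_cat !big_map !mulr_sumr.
by congr (_ + _); apply: eq_bigr => p _; rewrite mulrA.
Qed.

Lemma step_fun_shift a (phi : seq step) (x : R) :
  step_fun (map (step_shift a) phi) x = step_fun phi (x - a).
Proof.
rewrite /step_fun big_map; apply: eq_bigr => p _ /=; congr (_ * _).
by rewrite !indicE !mem_setE !in_itv/= ltrBrDr lerBlDr.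
Qed.

Lemma measurable_step_fun (phi : seq (@step R)) :
  measurable_fun [set: R] (step_fun phi).
Proof. by apply: measurable_sum => p; apply: measurable_funM. Qed.

Lemma measurable_fun_err (f : R -> R) (phi : seq (@step R)) :
  measurable_fun [set: R] f ->
  measurable_fun [set: measurableTypeR R] (fun x : R => f x - step_fun phi x).
Proof. by move=> mf; apply: measurable_funB => //; exact: measurable_step_fun. Qed.

Lemma measurable_integral_err (Y : Omega -> R) (phi : seq step) :
  measurable_fun setT Y ->
  measurable_fun setT (fun w => Y w - step_integral W phi w).
Proof.
by move=> mY; apply: measurable_funB => //; exact: (measurable_step_integral W_wiener).
Qed.

Lemma cvg_step_integral_sqr (phi : nat -> seq step) :
  (fun k => \int[mu]_x ((step_fun (phi k) x) ^+ 2)%:E)%E @ \oo --> 0%E ->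
  (fun k => \int[P]_w ((step_integral W (phi k) w) ^+ 2)%:E)%E @ \oo --> 0%E.
Proof.
move=> phi0; rewrite (_ : (fun k => _) = (fun k => (fine (@gauss_sqr R))%:E *
    \int[mu]_x ((step_fun (phi k) x) ^+ 2)%:E)%E); last first.
  by apply/funext => k; exact: wiener_isometry.
by rewrite -[X in _ --> X](mule0 (fine (@gauss_sqr R))%:E); exact: cvgeZl.
Qed.

Lemma wiener_integral_lin (a b : R) (f g : R -> R) (Y Z : Omega -> R) :
  measurable_fun [set: R] f -> measurable_fun [set: R] g ->
  wiener_integral P W f Y -> wiener_integral P W g Z ->
  wiener_integral P W (fun x => a * f x + b * g x)
    (fun w => a * Y w + b * Z w).
Proof.
move=> mf mg [mY [phi [fphi Yphi]]] [mZ [psi [gpsi Zpsi]]]; split.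
  by apply: measurable_funD; exact: measurable_funM.
exists (fun k => step_lin a b (phi k) (psi k)); split.
  apply: (@cvg_sqr_lin _ _ _ _ a b _ _ _ _
    (fun k => measurable_fun_err (_ k) mf)
    (fun k => measurable_fun_err (_ k) mg) fphi gpsi) => k x.
  by rewrite step_fun_lin; ring.
apply: (@cvg_sqr_lin _ _ _ _ a b _ _ _ _
    (fun k => measurable_integral_err (_ k) mY)
  (fun k => measurable_integral_err (_ k) mZ) Yphi Zpsi) => k x.
  by rewrite step_integral_lin; ring.
Qed.

(** Any approximating sequence may replace the one hidden in [wiener_integral]: two such sequences
    differ by step functions tending to 0 in L2, and the isometry sends this difference to 0 in
    L2(P). *)
Lemma wiener_integral_approx (f : R -> R) (Y : Omega -> R)
    (phi : nat -> seq step) :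
  measurable_fun [set: R] f -> wiener_integral P W f Y ->
  (fun k => \int[mu]_x ((f x - step_fun (phi k) x) ^+ 2)%:E)%E @ \oo --> 0%E ->
  (fun k => \int[P]_w ((Y w - step_integral W (phi k) w) ^+ 2)%:E)%E
    @ \oo --> 0%E.
Proof.
move=> mf [mY [psi [fpsi Ypsi]]] fphi.
have mI := measurable_step_integral W_wiener.
have diff0 : (fun k => \int[P]_w
    ((step_integral W (step_lin 1 (-1) (psi k) (phi k)) w) ^+ 2)%:E)%E
    @ \oo --> 0%E.
  apply: cvg_step_integral_sqr.
  apply: (@cvg_sqr_lin _ _ _ _ (-1) 1 _ _ _ _
    (fun k => measurable_fun_err (_ k) mf)
    (fun k => measurable_fun_err (_ k) mf) fpsi fphi) => k x.
  by rewrite step_fun_lin; ring.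
apply: (@cvg_sqr_lin _ _ _ _ 1 1 _ _ _ _
    (fun k => measurable_integral_err (_ k) mY) (fun k => mI _)
  Ypsi diff0) => k x.
  by rewrite step_integral_lin; ring.
Qed.

Lemma wiener_integral_unique (f : R -> R) (Y Z : Omega -> R) :
  measurable_fun [set: R] f -> wiener_integral P W f Y ->
  wiener_integral P W f Z -> {ae P, forall w, Y w = Z w}.
Proof.
move=> mf fY fZ; have [mY [phi [fphi Yphi]]] := fY; have [mZ _] := fZ.
have Zphi := wiener_integral_approx mf fZ fphi.
(* The sequence does not depend on [k], so its convergence to 0 makes its value 0. *)
have YZ : (fun k : nat => \int[P]_w ((Y w - Z w) ^+ 2)%:E)%E @ \oo --> 0%E.
  apply: (@cvg_sqr_lin _ _ _ _ 1 (-1) _ _ _ _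
    (fun k => measurable_integral_err (_ k) mY)
    (fun k => measurable_integral_err (_ k) mZ) Yphi Zphi) => k x.
  ring.
have /integral_sqr_eq0 : (\int[P]_w ((Y w - Z w) ^+ 2)%:E = 0)%E.
  by apply: cvg_unique YZ => //; exact: cvg_cst.
have mYZ : measurable_fun setT (fun w => Y w - Z w) by exact: measurable_funB.
by move=> /(_ mYZ); apply: filterS => w /eqP; rewrite subr_eq0 => /eqP.
Qed.

(** Some step integral is within second moment 1 of [Y], and its own second moment is finite by the
    isometry. *)
Lemma wiener_integral_fin (f : R -> R) (Y : Omega -> R) :
  wiener_integral P W f Y -> (\int[P]_w ((Y w) ^+ 2)%:E < +oo)%E.
Proof.
move=> [mY [phi [fphi Yphi]]].
have [k /= Yk] : exists k,
    (\int[P]_w ((Y w - step_integral W (phi k) w) ^+ 2)%:E < 1)%E.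
  have : nbhs (0%E : \bar R) [set x | (x < 1%:E)%E].
    by apply: open_nbhs_nbhs; split; [exact: open_ereal_lt_ereal|rewrite /= lte01].
  by move=> /Yphi [N _ /(_ N (leqnn N))]; exists N.
have -> : (\int[P]_w ((Y w) ^+ 2)%:E = \int[P]_w
    ((1 * (Y w - step_integral W (phi k) w) + 1 * step_integral W (phi k) w) ^+ 2)%:E)%E.
  by apply: eq_integral => w _; congr (EFin (_ ^+ 2)); ring.
have mI := measurable_step_integral W_wiener (phi k).
apply: le_lt_trans (integral_sqr_lin_le _ _ _ _ _) _ => //.
  exact: measurable_funB.
rewrite (wiener_isometry W_wiener) integral_step_fun_sqr -!EFinM.
apply: lte_add_pinfty; last by rewrite ltry.
apply: lte_mul_pinfty => //.
exact: lt_trans Yk (ltry _).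
Qed.

(** By translation invariance of Lebesgue measure, the shifted step functions approximate the
    shifted integrand with the same L2 error. *)
Lemma wiener_integral_shift (f : R -> R) a (Y : Omega -> R)
    (phi : nat -> seq step) :
  measurable_fun [set: R] f ->
  wiener_integral P W (fun x => f (x - a)) Y ->
  (fun k => \int[mu]_x ((f x - step_fun (phi k) x) ^+ 2)%:E)%E @ \oo --> 0%E ->
  (fun k => \int[P]_w
     ((Y w - step_integral W (map (step_shift a) (phi k)) w) ^+ 2)%:E)%E
    @ \oo --> 0%E.
Proof.
move=> mf fY fphi; apply: wiener_integral_approx fY _.
  by apply: measurableT_comp => //; exact: measurable_funB.
rewrite (_ : (fun k => _) =
  (fun k => \int[mu]_x ((f x - step_fun (phi k) x) ^+ 2)%:E)%E)//.
apply/funext => k; rewrite -[RHS](ge0_integral_translation a).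
- by apply: eq_integral => x _; rewrite step_fun_shift.
- apply/measurable_EFinP; apply: measurable_funX; apply: measurable_funB => //.
  exact: measurable_step_fun.
- by move=> x; rewrite lee_fin sqr_ge0.
Qed.

End wiener_integral_theory.

(** * Distribution functions under L2 limits *)

Section limit_laws.
Context {d : measure_display} {Omega : measurableType d} {R : realType}.
Variable P : probability Omega R.
Context {I : eqType} (l : seq I).
Implicit Types (Y Z : I -> Omega -> R) (c : I -> R).

Definition orthant Y c := [set w | forall i, i \in l -> Y i w <= c i].

Lemma measurable_orthant Y c : (forall i, measurable_fun setT (Y i)) ->
  measurable (orthant Y c).
Proof. by move=> mY; apply: measurable_forall_in => i _; exact: measurable_le. Qed.

(** Chebyshev's inequality for the sum of the squared differences: off the event where this sum is
    at least e^2, each [Z i] exceeds [Y i] by less than [e]. *)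
Lemma prob_orthant_le Y Z c e :
  (forall i, measurable_fun setT (Y i)) ->
  (forall i, measurable_fun setT (Z i)) -> 0 < e ->
  (P (orthant Y c) <= P (orthant Z (fun i => (c i + e)%R)) +
    (e ^+ 2)^-1%:E * \sum_(i <- l) \int[P]_w ((Y i w - Z i w) ^+ 2)%:E)%E.
Proof.
move=> mY mZ e0; have e20 : 0 < e ^+ 2 by rewrite exprn_gt0.
pose D w := \sum_(i <- l) (Y i w - Z i w) ^+ 2.
have mi i : measurable_fun setT (fun w => (Y i w - Z i w) ^+ 2).
  by apply: measurable_funX; exact: measurable_funB.
have mD : measurable_fun setT D by exact: measurable_sum.
have D0 w : 0 <= D w by apply: sumr_ge0 => i _; exact: sqr_ge0.
pose B := [set w | e ^+ 2 <= D w].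
have mB : measurable B by exact: measurable_ge.
have PB : (P B <=
    (e ^+ 2)^-1%:E * \sum_(i <- l) \int[P]_w ((Y i w - Z i w) ^+ 2)%:E)%E.
  rewrite -ge0_integral_sum//; last 2 first.
  - by move=> i; exact/measurable_EFinP.
  - by move=> i w _; rewrite lee_fin sqr_ge0.
  have := @le_integral_abse _ _ _ P setT measurableT (EFin \o D) (e ^+ 2).
  have mED : measurable_fun setT (EFin \o D) by exact/measurable_EFinP.
  move=> /(_ mED e20); rewrite setTI.
  under eq_integral do rewrite /= ger0_norm//.
  rewrite (_ : [set x | _] = B); last first.
    by apply/seteqP; split=> x /=; rewrite /B/= lee_fin ger0_norm.
  move=> H; rewrite -lee_pdivrMl// ?invr_gt0// invrK; apply: (le_trans H).
  by rewrite le_eqVlt; apply/orP; left; apply/eqP/eq_integral => w _; rewrite sumEFin.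
apply: (@le_trans _ _ (P (orthant Z (fun i => (c i + e)%R) `|` B))).
  apply: le_measure; rewrite ?inE; [exact: measurable_orthant| |].
    by apply: measurableU => //; exact: measurable_orthant.
  move=> w Yc; have [De|eD] := ltP (D w) (e ^+ 2); [left|by right].
  move=> i il; have := Yc i il.
  have : (Y i w - Z i w) ^+ 2 < e ^+ 2.
    apply: le_lt_trans De; rewrite /D (perm_big _ (perm_to_rem il)) big_cons.
    by rewrite lerDl sumr_ge0// => j _; exact: sqr_ge0.
  rewrite -(real_normK (num_real (Y i w - _))) ltr_sqr ?nnegrE ?(ltW e0)//.
  rewrite ltr_norml => /andP[]; lra.
apply: (@le_trans _ _ (P (orthant Z (fun i => (c i + e)%R)) + P B)%E).
  by apply: measureU2 => //; exact: measurable_orthant.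
by rewrite leeD2l.
Qed.

Lemma cvg_sum_sqr Y (Yk : nat -> I -> Omega -> R) (e : R) :
  (forall i, (fun k => \int[P]_w ((Y i w - Yk k i w) ^+ 2)%:E)%E
     @ \oo --> 0%E) ->
  (fun k => e%:E * \sum_(i <- l) \int[P]_w ((Y i w - Yk k i w) ^+ 2)%:E)%E
    @ \oo --> 0%E.
Proof.
move=> cY; rewrite -[X in _ --> X](mule0 e%:E); apply: cvgeZl => //.
have S0 : \sum_(i <- l) (0%E : \bar R) = 0%E by rewrite big1.
rewrite -[X in _ --> X]S0; apply: cvg_nnesum; last by move=> i _; exact: cY.
move=> i _.
by apply: nearW => k; apply: integral_ge0 => w _; rewrite lee_fin sqr_ge0.
Qed.

(** Going from [Y] to [Yk], across to [Zk] and on to [Z] costs a slack [e] twice, with Chebyshev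
    errors that vanish as k grows. As [e] decreases to 0, the enlarged closed orthants decrease to
    [orthant l Z c]. Exchanging [Y] and [Z] later gives equality. *)
Lemma prob_orthant_limit_le Y Z (Yk Zk : nat -> I -> Omega -> R) c :
  (forall i, measurable_fun setT (Y i)) ->
  (forall i, measurable_fun setT (Z i)) ->
  (forall k i, measurable_fun setT (Yk k i)) ->
  (forall k i, measurable_fun setT (Zk k i)) ->
  (forall i, (fun k => \int[P]_w ((Y i w - Yk k i w) ^+ 2)%:E)%E
     @ \oo --> 0%E) ->
  (forall i, (fun k => \int[P]_w ((Z i w - Zk k i w) ^+ 2)%:E)%E
     @ \oo --> 0%E) ->
  (forall k c, P (orthant (Yk k) c) = P (orthant (Zk k) c)) ->
  (P (orthant Y c) <= P (orthant Z c))%E.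
Proof.
move=> mY mZ mYk mZk cY cZ YZ.
have step e : 0 < e ->
    (P (orthant Y c) <= P (orthant Z (fun i => (c i + e + e)%R)))%E.
  move=> e0; pose r (U : I -> Omega -> R) (V : nat -> I -> Omega -> R) k :=
    ((e ^+ 2)^-1%:E * \sum_(i <- l) \int[P]_w ((U i w - V k i w) ^+ 2)%:E)%E.
  have cr : (fun k => P (orthant Z (fun i => (c i + e + e)%R)) +
      (r Z Zk k + r Y Yk k))%E @ \oo --> P (orthant Z (fun i => c i + e + e)).
    have c2 : (fun k => r Z Zk k + r Y Yk k)%E @ \oo --> 0%E.
      rewrite -[X in _ --> X]adde0.
      by apply: cvgeD => //; apply: cvg_sum_sqr.
    rewrite -[X in _ --> X]adde0; apply: cvgeD c2; last exact: cvg_cst.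
    exact: fin_num_adde_defl.
  apply: (cvge_to_ge cr); apply: nearW => k.
  apply: (le_trans (prob_orthant_le c mY (mYk k) e0)).
  rewrite YZ addeA; apply: leeD => //.
  apply: (le_trans (prob_orthant_le _ (mZk k) mZ e0)).
  rewrite leeD2l// lee_wpmul2l ?lee_fin ?invr_ge0 ?sqr_ge0//.
  apply: lee_sum => i _; rewrite le_eqVlt; apply/orP; left; apply/eqP.
  by apply: eq_integral => w _; rewrite -sqrrN opprB.
pose F n := orthant Z (fun i => c i + n.+1%:R^-1).
have FE : \bigcap_n F n = orthant Z c.
  apply/seteqP; split=> [w Fw i il|w Zc n _ i il]; last first.
    by apply: (le_trans (Zc i il)); rewrite lerDl invr_ge0.
  rewrite leNgt; apply/negP => /ltr_add_invr[n].
  by apply/negP; rewrite -leNgt; exact: Fw.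
have cF : (P \o F) n @[n --> \oo] --> P (orthant Z c).
  rewrite -FE; apply: nonincreasing_cvg_mu.
  - by rewrite (le_lt_trans (probability_le1 _ _)) ?ltry//; exact: measurable_orthant.
  - by move=> n; exact: measurable_orthant.
  - by rewrite FE; exact: measurable_orthant.
  - move=> m n mn; apply/subsetPset => w Fw i il; apply: (le_trans (Fw i il)).
    by rewrite lerD2l lef_pV2 ?posrE// ler_nat.
apply: (cvge_to_ge cF); apply: nearW => n /=.
(* Half of 1/(n+1), because the slack is paid twice. *)
have := step (n.+1%:R^-1 / 2); rewrite divr_gt0 ?invr_gt0// => /(_ isT).
rewrite (_ : (fun i => _) = (fun i => c i + n.+1%:R^-1))//.
by apply/funext => i; rewrite -addrA -splitr.
Qed.

End limit_laws.

Section wiener_integral_law.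
Context {d : measure_display} {Omega : measurableType d} {R : realType}.
Variables (P : probability Omega R) (W : R -> Omega -> R).
Hypothesis W_wiener : wiener_process P W.

(** The step functions approximating [f i] approximate its translate once shifted by [a]. At each
    stage the joint laws agree, and the limit inequality is applied in both directions. *)
Lemma wiener_integral_law_shift (I : eqType) (l : seq I) (f : I -> R -> R) a
    (Y Z : I -> Omega -> R) (c : I -> R) :
  (forall i, measurable_fun [set: R] (f i)) ->
  (forall i, wiener_integral P W (f i) (Y i)) ->
  (forall i, wiener_integral P W (fun x => f i (x - a)) (Z i)) ->
  P (orthant l Y c) = P (orthant l Z c).
Proof.
move=> mf fY fZ.
have /choice[phi phiP] : forall i, exists phi : nat -> seq step,
    (fun k => \int[lebesgue_measure]_x
       ((f i x - step_fun (phi k) x) ^+ 2)%:E)%E @ \oo --> 0%E /\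
    (fun k => \int[P]_w ((Y i w - step_integral W (phi k) w) ^+ 2)%:E)%E
      @ \oo --> 0%E by move=> i; case: (fY i).
have cZ i := wiener_integral_shift W_wiener (mf i) (fZ i) (phiP i).1.
have mI k i := measurable_step_integral W_wiener (phi i k).
have mJ k i :=
  measurable_step_integral W_wiener (map (step_shift a) (phi i k)).
have mY i : measurable_fun setT (Y i) by case: (fY i).
have mZ i : measurable_fun setT (Z i) by case: (fZ i).
have eqlaw k c' := step_integral_law_shift W_wiener l (fun i => phi i k) c' a.
apply/eqP; rewrite eq_le; apply/andP; split.
  apply: (@prob_orthant_limit_le _ _ _ P I l Y Z
    (fun k i => step_integral W (phi i k))
    (fun k i => step_integral W (map (step_shift a) (phi i k)))) => //.
    by move=> i; exact: (phiP i).2.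
  by move=> k c'; exact/esym/eqlaw.
apply: (@prob_orthant_limit_le _ _ _ P I l Z Y
  (fun k i => step_integral W (map (step_shift a) (phi i k)))
  (fun k i => step_integral W (phi i k))) => //.
by move=> i; exact: (phiP i).2.
Qed.

End wiener_integral_law.

(** * Borel sets of C([0, h]) *)

Lemma measurable_fun_le {R : realType} d (T : measurableType d) (f : T -> R) :
  (forall c, measurable [set x | f x <= c]) -> measurable_fun setT f.
Proof.
move=> mf; apply: (measurability _ (RGenOInfty.measurableE R)).
move=> _ [_ [r ->] <-]; rewrite setTI.
rewrite (_ : _ @^-1` _ = ~` [set x | f x <= r]); first exact: measurableC.
by apply/seteqP; split=> x /=; rewrite in_itv/= andbT ltNge => /negP.
Qed.

Section C0_measurability.
Context {R : realType} {h : {posnum R}}.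
Local Notation I := (set_type `[0%R, h%:num]).

Fact clamp_subproof (x : R) :
  Num.max 0 (Num.min x h%:num) \in [set` `[0%R, h%:num]].
Proof. by rewrite inE/= in_itv/= le_max lexx/= ge_max ge_min lexx orbT ge0. Qed.

(** Retraction of the line onto [0, h]. It extends paths to continuous functions on R, so that
    evaluation times can be indexed by all of [rat]. *)
Definition clamp (x : R) : I := 
  exist _ (Num.max 0 (Num.min x h%:num)) (clamp_subproof x).

Lemma clampK (t : I) : clamp (set_val t) = t.
Proof.
apply/val_inj => /=; have := set_valP t; rewrite /= in_itv/= => /andP[t0 th].
by rewrite (min_idPl th) (max_idPr t0).
Qed.

Lemma continuous_clamp : continuous clamp.
Proof.
apply: continuous_comp_initial => x.
apply: (@continuous_max _ _ (cst 0) (fun x => Num.min x h%:num)).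
  exact: cst_continuous.
apply: (@continuous_min _ _ id (cst h%:num)); last exact: cst_continuous.
exact: cvg_id.
Qed.

Definition C0_ext (x : C0 h) : R -> R := x \o clamp.

Lemma continuous_C0_ext (x : C0 h) : continuous (C0_ext x).
Proof.
move=> t; apply: continuous_comp; first exact: continuous_clamp.
exact: C0_cts.
Qed.

Lemma continuous_le_rat (f : R -> R) c : continuous f ->
  (forall q : rat, f (ratr q) <= c) -> forall x, f x <= c.
Proof.
move=> cf fc x; rewrite leNgt; apply/negP => cx.
have oU : open (f @^-1` [set y | c < y]).
  by move/continuousP: cf; apply; exact: open_gt.
have [y [cfy [q _ qy]]] := @dense_rat R _ (ex_intro _ x cx) oU.
by move: cfy; rewrite -qy /= ltNge fc.
Qed.

Lemma C0_norm_le_rat (x : C0 h) c :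
  (forall q : rat, `|C0_ext x (ratr q)| <= c) -> `|x| <= c.
Proof.
move=> xc; apply: C0_norm_le => t.
have cx : continuous (fun s => `|C0_ext x s|).
  by move=> s; apply: cvg_norm; exact: continuous_C0_ext.
by have := continuous_le_rat cx xc (set_val t); rewrite /C0_ext/= clampK.
Qed.

Lemma C0_eq_rat (x y : C0 h) :
  (forall q : rat, C0_ext x (ratr q) = C0_ext y (ratr q)) -> x = y.
Proof.
move=> xy; apply/eqP; rewrite -subr_eq0 -normr_le0; apply: C0_norm_le_rat => q.
have -> : C0_ext (x - y) (ratr q) = C0_ext x (ratr q) - C0_ext y (ratr q).
  by [].
by rewrite xy subrr normr0.
Qed.

(** Heine's theorem, from the near-covering form of compactness of [0, h]. The modulus is taken as
    1/(N+1) so that [N] can serve as a mesh. *)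
Lemma C0_ext_unif (x : C0 h) e : 0 < e ->
  exists N : nat, forall s, 0 <= s <= h%:num -> forall t,
    `|s - t| < N.+1%:R^-1 -> `|C0_ext x s - C0_ext x t| < e.
Proof.
move=> e0; have e20 : 0 < e / 2 by rewrite divr_gt0.
have /compact_near_coveringP cov := @segment_compact R 0 h%:num.
pose Q (N : nat) (s : R) := forall t,
    `|s - t| < N.+1%:R^-1 -> `|C0_ext x s - C0_ext x t| < e.
have : \forall N \near \oo, `[0, h%:num]%classic `<=` Q N.
  apply: cov => s _.
  have /cvgrPdist_lt/(_ _ e20) := @continuous_C0_ext x s.
  move=> /nbhs_ballP[r /= r0 sr].
  have r20 : 0 < r / 2 by rewrite divr_gt0.
  near=> s' N => t st.
  have ss' : `|s - s'| < r / 2 by near: s'; apply: nbhsx_ballx.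
  have Nr : N.+1%:R^-1 < r / 2.
    by near: N; exact: (near_infty_natSinv_lt (PosNum r20)).
  have d1 : `|C0_ext x s - C0_ext x s'| < e / 2.
    by apply: sr; rewrite -ball_normE /=; lra.
  have d2 : `|C0_ext x s - C0_ext x t| < e / 2.
    apply: sr; rewrite -ball_normE /=.
    have st' := lt_trans st Nr.
    by apply: (le_lt_trans (ler_distD s' _ _)); lra.
  by apply: (le_lt_trans (ler_distD (C0_ext x s) _ _)); rewrite distrC; lra.
move=> [N _ /(_ N (leqnn N)) NQ]; exists N => s s0h; apply: NQ.
by rewrite /= in_itv.
Unshelve. all: by end_near. Qed.

Lemma measurable_forall_rat d (T : measurableType d) (A : rat -> set T) :
  (forall q, measurable (A q)) -> measurable [set x | forall q, A q x].
Proof.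
move=> mA; rewrite (_ : [set x | _] = ~` \bigcup_q ~` A q); last first.
  apply/seteqP; split=> x /=; first by move=> Ax [q _]; apply; exact: Ax.
  by move=> nA q; apply: contrapT => nAx; apply: nA; exists q.
apply: measurableC; apply: countable_bigcupT_measurable => [|q].
  exact: countableP.
exact: measurableC.
Qed.

(** Paths within 1/(M+1) of the function with rational value v_j on the j-th cell of mesh 1/(N+1).
    The parameters are countable and the test involves countably many times. The centre is a step
    function, which may lie outside C([0, h]). *)
Definition step_nbhd (N M : nat) (v : seq rat) : set (C0 h) :=
  [set x | forall q : rat, `|C0_ext x (ratr q) -
    ratr (nth 0 v (Num.truncn (set_val (clamp (ratr q)) * N.+1%:R)))|
    <= M.+1%:R^-1].

Lemma step_nbhd_diam N M v x y : step_nbhd N M v x -> step_nbhd N M v y ->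
  `|x - y| <= 2 / M.+1%:R.
Proof.
move=> Nx Ny; apply: C0_norm_le_rat => q.
have -> : C0_ext (x - y) (ratr q) = C0_ext x (ratr q) - C0_ext y (ratr q).
  by [].
apply: (le_trans (ler_distD (ratr (nth 0 v
  (Num.truncn (set_val (clamp (ratr q)) * N.+1%:R)))) _ _)).
rewrite mulr_natl mulr2n.
by apply: lerD; [exact: Nx|rewrite distrC; exact: Ny].
Qed.

Lemma step_nbhd_cover (x : C0 h) M : exists N v, step_nbhd N M v x.
Proof.
have e0 : 0 < M.+1%:R^-1 / 2 :> R by rewrite divr_gt0 ?invr_gt0.
have [N xN] := C0_ext_unif x e0.
have approx (j : nat) : exists q : rat,
    `|C0_ext x (j%:R / N.+1%:R) - ratr q| < M.+1%:R^-1 / 2.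
  set y := C0_ext _ _.
  have [|q] := @rat_in_itvoo R (y - M.+1%:R^-1 / 2) (y + M.+1%:R^-1 / 2).
    by rewrite ltrD2l gtrN.
  rewrite in_itv/= => /andP[q1 q2]; exists q.
  by rewrite distrC ltr_distl q1 q2.
have [v vP] := choice approx.
(* The successor makes room for the cell that contains the right endpoint [h]. *)
pose K := (Num.truncn (h%:num * N.+1%:R)).+1.
exists N, (mkseq v K) => q; set s := set_val _; set j := Num.truncn _.
have s0h : 0 <= s <= h%:num by have := set_valP (clamp (ratr q)); rewrite /= in_itv.
have [s0 sh] := andP s0h.
have jE : (j%:R <= s * N.+1%:R < j.+1%:R) by apply: truncn_itv; rewrite mulr_ge0.
have jK : (j < K)%N.
  rewrite ltnS; apply: le_truncn; exact: ler_wpM2r.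
rewrite nth_mkseq//.
have -> : C0_ext x (ratr q) = C0_ext x s by rewrite /C0_ext/= clampK.
have N0 : 0 < N.+1%:R :> R by [].
have d1 : `|C0_ext x s - C0_ext x (j%:R / N.+1%:R)| < M.+1%:R^-1 / 2.
  apply: xN => //; case/andP: jE => j1 j2.
  rewrite ger0_norm ?subr_ge0 ?ler_pdivrMr//.
  rewrite ltrBlDr -{1}[N.+1%:R^-1]mul1r -mulrDl ltr_pdivlMr//.
  by rewrite nat1r.
apply: (le_trans (ler_distD (C0_ext x (j%:R / N.+1%:R)) _ _)).
by rewrite [leRHS]splitr lerD// ltW//; exact: vP.
Qed.

(* The Borel sigma-algebra of C([0, h]) is generated by evaluations: an open
   set is a countable union of sets [step_nbhd], which are cylinders. *)
Lemma measurable_fun_C0 d (T : measurableType d) (F : T -> C0 h) :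
  (forall q : rat, measurable_fun setT (fun w => C0_ext (F w) (ratr q))) ->
  measurable_fun setT F.
Proof.
move=> mF; apply: (measurability _ (erefl : measurable = <<s @open (C0 h) >>)).
move=> _ [U oU <-]; rewrite setTI.
pose B (p : nat * nat * seq rat) := [set w |
  step_nbhd p.1.1 p.1.2 p.2 `<=` U /\ step_nbhd p.1.1 p.1.2 p.2 (F w)].
rewrite (_ : F @^-1` U = \bigcup_p B p); last first.
  apply/seteqP; split=> [w /= UFw|w [[[N M] v] _ [/= sub]]]; last exact: sub.
  have /nbhs_ballP[e /= e0 eU] : nbhs (F w) U by exact: open_nbhs_nbhs.
  have [M Me] : exists M : nat, 2 / M.+1%:R < e.
    have e20 : 0 < e / 2 by rewrite divr_gt0.
    have [M _ /(_ M (leqnn M))] := near_infty_natSinv_lt (PosNum e20).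
    by rewrite /= => Me; exists M; rewrite mulrC -ltr_pdivlMr.
  have [N [v NMv]] := step_nbhd_cover (F w) M.
  exists (N, M, v) => //; split=> // y yv; apply: eU; rewrite -ball_normE /=.
  by apply: le_lt_trans Me; exact: step_nbhd_diam NMv yv.
apply: countable_bigcupT_measurable => [|[[N M] v]]; first exact: countableP.
(* The inclusion in [U] does not depend on [w], so each piece is either empty or a full cylinder. *)
rewrite /B/=; have [sub|nsub] := pselect (step_nbhd N M v `<=` U); last first.
  by rewrite (_ : [set w | _] = set0)//; apply/seteqP; split=> // w [].
rewrite (_ : [set w | _] = [set w | step_nbhd N M v (F w)]); last first.
  by apply/seteqP; split=> [w []//|w]; split.
apply: measurable_forall_rat => q; apply: measurable_le.
by apply: measurableT_comp => //; exact: measurable_funB.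
Qed.

Lemma measurable_C0_eval (t : I) : measurable_fun setT (fun x : C0 h => x t).
Proof.
apply: (measurability _ (RGenOpens.measurableE R)).
move=> _ [_ [a [b ->] <-]]; rewrite setTI; apply: sub_sigma_algebra.
have cev : continuous (fun x : C0 h => x t).
  move=> x; apply: (iffRL (@cvgrPdist_lt _ R _ (nbhs x) _ _ _)) => e e0.
  apply/nbhs_ballP; exists e => //= y; rewrite -ball_normE/=.
  by apply: le_lt_trans; exact: (C0_norm_ub (x - y)).
by move/continuousP : cev; apply; exact: interval_open.
Qed.

Lemma measurable_C0_norm d (T : measurableType d) (F : T -> C0 h) :
  (forall q : rat, measurable_fun setT (fun w => C0_ext (F w) (ratr q))) ->
  measurable_fun setT (fun w => `|F w|).
Proof.
move=> mF; apply: measurable_fun_le => c.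
rewrite (_ : [set w | _] = [set w | forall q : rat,
    `|C0_ext (F w) (ratr q)| <= c]).
  apply: measurable_forall_rat => q; apply: measurable_le.
  exact: measurableT_comp.
apply/seteqP; split=> w /=; last exact: C0_norm_le_rat.
by move=> Fc q; apply: le_trans Fc; exact: C0_norm_ub.
Qed.

(** Each constraint is a coordinate, a rational time and an upper bound. With a list of them,
    intersection is concatenation, and the preimage under a tuple of paths is an [orthant]. *)
Definition evaluation_box m : set (set (m.-tuple (C0 h))) :=
  [set B | exists s : seq ('I_m * rat * R), B = [set u | forall p, p \in s ->
     C0_ext (tnth u p.1.1) (ratr p.1.2) <= p.2]].

Lemma evaluation_box_measurable m : @evaluation_box m `<=` measurable.
Proof.
move=> _ [s ->]; apply: measurable_forall_in => p _; apply: measurable_le.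
apply: (@measurableT_comp _ _ _ _ _ _ (fun x : C0 h => x (clamp (ratr p.1.2)))).
  exact: measurable_C0_eval.
exact: measurable_tnth.
Qed.

Lemma evaluation_box_setI_closed m : setI_closed (@evaluation_box m).
Proof.
move=> _ _ [s ->] [s' ->]; exists (s ++ s'); apply/seteqP.
split=> u /= => [[us us'] p|uss'].
  by rewrite mem_cat => /orP[]; [exact: us|exact: us'].
by split=> p ps; apply: uss'; rewrite mem_cat ps ?orbT.
Qed.

(** [measurable_fun_C0] is applied with the sigma-algebra generated by the boxes on the source,
    where the evaluations of a coordinate are measurable by construction. *)
Lemma measurable_evaluation_boxE m :
  @measurable _ (m.-tuple (C0 h)) = <<s @evaluation_box m >>.
Proof.
apply: measurable_tupleE; first exact: evaluation_box_measurable.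
move=> i C mC.
have mi : @measurable_fun _ _ (g_sigma_algebraType (@evaluation_box m)) (C0 h)
    setT (fun u => tnth u i).
  apply: measurable_fun_C0 => q.
  apply: measurable_fun_le => c; apply: sub_sigma_algebra.
  exists [:: (i, q, c)]; apply/seteqP; split=> u /=.
    by move=> uc p; rewrite inE => /eqP ->.
  by move=> /(_ (i, q, c)); rewrite inE eqxx => /(_ isT).
by have := mi measurableT C mC; rewrite setTI.
Qed.

End C0_measurability.

(** * Solutions of the autoregression *)

Section rho_iterates.
Context {R : realType} {h : {posnum R}} (theta : R).
Local Notation I := (set_type `[0%R, h%:num]).
Local Notation q := (expR (- theta * h%:num)).

Lemma iter_rhoD k (x y : C0 h) :
  iter k (rho theta) (x + y) = iter k (rho theta) x + iter k (rho theta) y.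
Proof.
elim: k => //= k ->; apply/C0P => t.
exact: mulrDr.
Qed.

Lemma iter_rhoSE k (x : C0 h) (t : I) : iter k.+1 (rho theta) x t =
  expR (- theta * set_val t) * (q ^+ k * x (C0_end h)).
Proof.
elim: k t => [|k IH] t; first by rewrite expr0 mul1r.
by rewrite iterS [LHS]/(_ * _) IH exprS mulrA.
Qed.

(** The exponent lags by one because the outermost factor exp(-theta t) is bounded only by 1, its
    value at t = 0. The bound sees [x] through the real number x(h), whose moments and tails are
    accessible. *)
Lemma norm_iter_rho k (x : C0 h) : 0 < theta ->
  `|iter k.+1 (rho theta) x| <= q ^+ k * `|x (C0_end h)|.
Proof.
move=> theta0; apply: C0_norm_le => t; rewrite iter_rhoSE !normrM.
rewrite (ger0_norm (expR_ge0 _)) normrX (ger0_norm (expR_ge0 _)).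
rewrite ler_piMl ?mulr_ge0// ?exprn_ge0 ?expR_ge0//.
rewrite -expR0 ler_expR mulNr oppr_le0 mulr_ge0 ?(ltW theta0)//.
by have := set_valP t; rewrite /= in_itv => /andP[].
Qed.

Lemma measurable_iter_rho d (T : measurableType d) (F : T -> C0 h) :
  (forall t, measurable_fun setT (fun w => F w t)) ->
  forall k t, measurable_fun setT (fun w => iter k (rho theta) (F w) t).
Proof.
by move=> mF; elim=> [//|k IH] t; apply: measurable_funM => //; exact: IH.
Qed.

Lemma measurable_series_rho d (T : measurableType d) (F : nat -> T -> C0 h) :
  (forall k t, measurable_fun setT (fun w => F k w t)) ->
  forall K t, measurable_fun setT
    (fun w => series (fun k => iter k (rho theta) (F k w)) K t).
Proof.
move=> mF; elim=> [|K IH] t.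
  rewrite (_ : (fun w => _) = cst 0)//.
  by apply/funext => w; rewrite /series/= big_geq.
rewrite (_ : (fun w => _) = (fun w =>
    series (fun k => iter k (rho theta) (F k w)) K t +
    iter K (rho theta) (F K w) t)); last first.
  by apply/funext => w; rewrite /series/= big_nat_recr.
by apply: measurable_funD; [exact: IH|exact: measurable_iter_rho].
Qed.

Lemma ar1_series (x e : int -> C0 h) :
  (forall n, x n = rho theta (x (n - 1)) + e n) ->
  forall n K, series (fun k => iter k (rho theta) (e (n - k%:Z))) K =
    x n - iter K (rho theta) (x (n - K%:Z)).
Proof.
move=> xe n; elim=> [|K IH].
  by rewrite /series/= big_geq// subr0 subrr.
rewrite /series/= big_nat_recr//= -[X in X + _]/(series _ K) IH -iterS iterSr.
rewrite (xe (n - K%:Z)) iter_rhoD opprD -!addrA; congr (_ + _).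
rewrite addNr addr0; congr (- iter K _ (rho _ (x _))).
by rewrite intS [1 + _]addrC opprD addrA.
Qed.

Lemma ar1_diff (x y e : int -> C0 h) :
  (forall n, x n = rho theta (x (n - 1)) + e n) ->
  (forall n, y n = rho theta (y (n - 1)) + e n) ->
  forall n K, x n - y n =
    iter K (rho theta) (x (n - K%:Z)) - iter K (rho theta) (y (n - K%:Z)).
Proof.
move=> xe ye n K; have := ar1_series xe n K; rewrite (ar1_series ye).
move/eqP; rewrite eq_sym subr_eq => /eqP {1}->.
by rewrite addrAC (addrAC (y n)) subrr add0r addrC.
Qed.

End rho_iterates.

Section stationary_marginals.
Context {d : measure_display} {Omega : measurableType d} {R : realType}.
Variable P : probability Omega R.
Context {d' : measure_display} {T : measurableType d'}.
Variable X : int -> Omega -> T.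
Hypothesis X_stationary : strictly_stationary P X.

Lemma stationary_marginal n (B : set T) : measurable B ->
  P (X n @^-1` B) = P (X 0 @^-1` B).
Proof.
move=> mB; have [mX stat] := X_stationary.
have mA : measurable [set u : 1.-tuple T | B (tnth u ord0)].
  by rewrite -[X in measurable X]setTI; exact: measurable_tnth.
have := stat 1 (fun=> 0) n _ mA; rewrite add0r.
rewrite (_ : [set w | _] = X n @^-1` B); last first.
  by apply/seteqP; split=> w /=; rewrite tnth_mktuple.
by move=> ->; congr (P _); apply/seteqP; split=> w /=; rewrite tnth_mktuple.
Qed.

Lemma stationary_integral n (f : T -> \bar R) : measurable_fun setT f ->
  (forall x, 0 <= f x)%E ->
  (\int[P]_w f (X n w) = \int[P]_w f (X 0 w))%E.
Proof.
move=> mf f0; have [mX _] := X_stationary.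
pose mf0 := isMeasurableFun.Build _ _ _ _ _ (mX 0).
pose mfn := isMeasurableFun.Build _ _ _ _ _ (mX n).
pose X0 : {mfun Omega >-> T} := HB.pack (X 0) mf0.
pose Xn : {mfun Omega >-> T} := HB.pack (X n) mfn.
transitivity (\int[pushforward P Xn]_x f x)%E.
  by rewrite ge0_integral_pushforward// => x _; exact: f0.
transitivity (\int[pushforward P X0]_x f x)%E; last first.
  by rewrite ge0_integral_pushforward// => x _; exact: f0.
by apply: eq_measure_integral => A mA _; exact: stationary_marginal.
Qed.

(** Tightness uniform in [n]: the events decrease to the empty set at time 0, and stationarity gives
    the same bounds at all times. *)
Lemma stationary_tail (f : T -> R) : measurable_fun setT f ->
  exists a : nat -> \bar R, a @ \oo --> 0%E /\
    forall n k, P [set w | k%:R <= f (X n w)] = a k.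
Proof.
move=> mf; have [mX _] := X_stationary.
have mB c : measurable [set x | c <= f x] by exact: measurable_ge.
exists (fun k => P [set w | k%:R <= f (X 0 w)]); split; last first.
  by move=> n k; exact: (stationary_marginal n (mB k%:R)).
have mF k : measurable [set w | k%:R <= f (X 0 w)].
  by rewrite -[X in measurable X]setTI; exact: (mX 0 measurableT _ (mB k%:R)).
have F0 : \bigcap_k [set w | k%:R <= f (X 0 w)] = set0.
  apply/seteqP; split=> // w /(_ (Num.truncn (f (X 0 w))).+1 I) /=.
  by rewrite leNgt truncnS_gt.
rewrite -(measure0 P) -F0; apply: nonincreasing_cvg_mu => //.
- by rewrite (le_lt_trans (probability_le1 _ _)) ?ltry.
- by rewrite F0.
- move=> m n mn; apply/subsetPset => w /=; apply: le_trans.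
  by rewrite ler_nat.
Qed.

End stationary_marginals.

Lemma ae_forall_countable {R : realType} d (T : measurableType d)
    (m : {measure set T -> \bar R}) (I : countType) (Q : I -> T -> Prop) :
  (forall i, {ae m, forall x, Q i x}) -> {ae m, forall x, forall i, Q i x}.
Proof.
move=> aeQ; pose Q' k x := if unpickle k is Some i then Q i x else True.
have : {ae m, forall x, forall k, Q' k x}.
  apply: ae_foralln => k; rewrite /Q'; case: (unpickle k) => [i|].
    exact: aeQ.
  exact: aeW.
by apply: filterS => x Qx i; have := Qx (pickle i); rewrite /Q' pickleK.
Qed.

(** * Uniqueness of the stationary solution *)

Section uniqueness.
Context {d : measure_display} {Omega : measurableType d} {R : realType}.
Variable P : probability Omega R.
Context {h : {posnum R}}.
Variables (theta : R) (eps X Y : int -> Omega -> C0 h).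
Hypotheses (theta_gt0 : 0 < theta).
Local Notation q := (expR (- theta * h%:num)).

Lemma contraction_lt1 : q < 1.
Proof. by rewrite expR_lt1 mulNr oppr_lt0 mulr_gt0. Qed.

Lemma cvg_contraction (c : R) : (fun K => q ^+ K * c) @ \oo --> 0.
Proof.
rewrite -(mul0r c); apply: cvgMl.
by apply: cvg_expr; rewrite ger0_norm ?expR_ge0// contraction_lt1.
Qed.

(* The difference of two solutions contracts by q at each step backwards,
   while stationarity keeps the law of its starting value tight. *)
Lemma ar1_unique :
  strictly_stationary P X -> ar1_solution P theta eps X ->
  strictly_stationary P Y -> ar1_solution P theta eps Y ->
  {ae P, forall w, forall n, Y n w = X n w}.
Proof.
move=> sX arX sY arY; have [mX _] := sX; have [mY _] := sY.
have mev (Z : int -> Omega -> C0 h) n t : measurable_fun setT (Z n) ->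
    measurable_fun setT (fun w => Z n w t).
  by move=> mZ; apply: (measurableT_comp (measurable_C0_eval t)).
have mend : measurable_fun setT (fun x : C0 h => `|x (C0_end h)|).
  by apply: measurableT_comp => //; exact: measurable_C0_eval.
have [aX [aX0 aXE]] := stationary_tail sX mend.
have [aY [aY0 aYE]] := stationary_tail sY mend.
have mnorm n : measurable_fun setT (fun w => `|Y n w - X n w|).
  apply: measurable_C0_norm => r.
  by apply: (@measurable_funB _ _ _ _ (fun w => Y n w _) (fun w => X n w _));
    exact: mev.
have [N [mN PN subN]] : {ae P, forall w,
    (forall n, X n w = rho theta (X (n - 1) w) + eps n w) /\
    (forall n, Y n w = rho theta (Y (n - 1) w) + eps n w)}.
  exact: filterI arX arY.
have P0 n e : 0 < e -> P [set w | e <= `|Y n w - X n w|] = 0%E.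
  move=> e0; apply/eqP; rewrite eq_le measure_ge0 andbT.
  have ca : (fun k => aY k + aX k)%E @ \oo --> 0%E.
    by rewrite -[X in _ --> X]adde0; exact: cvgeD.
  apply: (cvge_to_ge ca); apply: nearW => k.
  (* The level [k] is fixed before [K]: the tail probabilities [aY k] and [aX k] are the same at
     every time, so the starting time may recede freely. The factor 2 counts the two solutions. *)
  have [K Kk] : exists K, q ^+ K * (2 * k%:R) < e.
    have /cvgrPdist_lt/(_ _ e0)[K _ /(_ K (leqnn K))] := cvg_contraction (2 * k%:R).
    by rewrite /= sub0r normrN => /(le_lt_trans (ler_norm _)); exists K.
  pose m := n - K.+1%:Z.
  pose BY := [set w | k%:R <= `|Y m w (C0_end h)|].
  pose BX := [set w | k%:R <= `|X m w (C0_end h)|].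
  have mBY : measurable BY.
    by apply: measurable_ge; apply: measurableT_comp => //; exact: mev.
  have mBX : measurable BX.
    by apply: measurable_ge; apply: measurableT_comp => //; exact: mev.
  rewrite -(aYE m k) -(aXE m k) -/BY -/BX.
  apply: (@le_trans _ _ (P ((BY `|` BX) `|` N))); last first.
    apply: (le_trans (measureU2 _ _ _)) => //; first exact: measurableU.
    rewrite -[leRHS]adde0; apply: leeD; first exact: measureU2.
    by rewrite le_eqVlt; apply/orP; left; apply/eqP; exact: PN.
  apply: le_measure; rewrite ?inE; [exact: measurable_ge| |].
    by apply: measurableU => //; exact: measurableU.
  move=> w /= ew; have [Nw|nNw] := pselect (N w); [by right|left].
  have [Xw Yw] : (forall n, X n w = rho theta (X (n - 1) w) + eps n w) /\
    (forall n, Y n w = rho theta (Y (n - 1) w) + eps n w).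
    by apply: contrapT => nXY; apply: nNw; exact: subN.
  have [|Yk] := leP k%:R `|Y m w (C0_end h)|; [by left|].
  have [|Xk] := leP k%:R `|X m w (C0_end h)|; [by right|].
  suff : e < e by rewrite ltxx.
  apply: (le_lt_trans ew); apply: le_lt_trans Kk.
  rewrite (ar1_diff Yw Xw n K.+1) (le_trans (ler_normB _ _))//.
  rewrite mulrDl mul1r mulrDr lerD//.
    apply: (le_trans (norm_iter_rho _ _ theta_gt0)).
    by rewrite ler_wpM2l ?exprn_ge0 ?expR_ge0// ltW.
  apply: (le_trans (norm_iter_rho _ _ theta_gt0)).
  by rewrite ler_wpM2l ?exprn_ge0 ?expR_ge0// ltW.
apply: ae_forall_countable => n.
have : {ae P, forall w, forall j : nat, `|Y n w - X n w| < j.+1%:R^-1}.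
  apply: ae_foralln => j; exists [set w | j.+1%:R^-1 <= `|Y n w - X n w|].
  split; [exact: measurable_ge|by apply: P0; rewrite invr_gt0|].
  by move=> w /= /negP; rewrite -leNgt.
apply: filterS => w YX; apply/eqP; rewrite -subr_eq0 -normr_le0 leNgt.
apply/negP => /ltr_add_invr[j]; rewrite add0r => /(lt_trans (YX j)).
by rewrite ltxx.
Qed.

End uniqueness.

(** * The Ornstein-Uhlenbeck process as an autoregression in C([0, h]) *)

Section ornstein_uhlenbeck_autoregression.
Context {R : realType} {d : measure_display} {Omega : measurableType d}.
Variables (P : probability Omega R) (W : R -> Omega -> R) (theta : R).
Variables (h : {posnum R}) (xi : R -> Omega -> R).
Variables (X eps : int -> Omega -> C0 h).
Hypothesis theta_gt0 : 0 < theta.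
Hypothesis W_wiener : wiener_process P W.
Hypothesis xi_ou : ornstein_uhlenbeck P W theta xi.
Hypothesis X_def : forall n w (t : set_type `[0%R, h%:num]),
  X n w t = xi (n%:~R * h%:num + set_val t) w.
Hypothesis eps_def : innovations P W theta eps.
Local Notation I := (set_type `[0%R, h%:num]).
Local Notation q := (expR (- theta * h%:num)).

Lemma measurable_exp_kernel (D : set R) t : measurable D ->
  measurable_fun [set: R] (fun s => \1_D s * expR (- theta * (t - s))).
Proof.
move=> mD; apply: measurable_funM; first exact: measurable_indic.
apply: measurableT_comp => //; apply: measurable_funM => //.
exact: measurable_funB.
Qed.

Lemma measurable_xi t : measurable_fun setT (xi t).
Proof. by case: (ou_integral xi_ou t). Qed.

Lemma measurable_X_eval n t : measurable_fun setT (fun w => X n w t).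
Proof. under eq_fun do rewrite X_def; exact: measurable_xi. Qed.

Lemma measurable_eps_eval n t : measurable_fun setT (fun w => eps n w t).
Proof. by case: (eps_def n t). Qed.

(** Shifting the index by [k] shifts time by kh, and the kernel of [xi] at the later time is the
    translate by kh of the earlier one. *)
Lemma ou_stationary : strictly_stationary P X.
Proof.
have mX n : measurable_fun setT (X n).
  by apply: measurable_fun_C0 => r; exact: measurable_X_eval.
split=> // m n k A mA.
have mtuple (j : 'I_m -> int) :
    measurable_fun setT (fun w => [tuple X (j i) w | i < m]).
  apply/measurable_fun_tnthP => i.
  apply: (eq_measurable_fun (X (j i))); last exact: mX.
  by move=> w _ /=; rewrite tnth_mktuple.
apply: (@eq_law R d _ Omega (m.-tuple (C0 h)) P
  (fun w => [tuple X (n i + k) w | i < m]) (fun w => [tuple X (n i) w | i < m])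
  _ (measurable_evaluation_boxE m)) => //.
- exact: evaluation_box_setI_closed.
- by exists [::]; apply/seteqP; split.
move=> _ [s ->].
pose tm (p : 'I_m * rat * R) (j : int) : R :=
  (n p.1.1 + j)%:~R * h%:num + set_val (@clamp R h (ratr p.1.2)).
have boxE j : (fun w => [tuple X (n i + j) w | i < m]) @^-1`
    [set u | forall p, p \in s -> C0_ext (tnth u p.1.1) (ratr p.1.2) <= p.2] =
    orthant s (fun p => xi (tm p j)) snd.
  apply/seteqP; split=> w /= H p ps; have := H p ps.
    by rewrite tnth_mktuple /C0_ext/= X_def.
  by rewrite tnth_mktuple /C0_ext/= X_def.
(* Writing the original tuple as a shift by 0 lets [boxE] treat both sides. *)
rewrite boxE (_ : (fun w => _) = (fun w => [tuple X (n i + 0) w | i < m])).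
  rewrite boxE; apply/esym.
  apply: (@wiener_integral_law_shift _ _ _ _ _ W_wiener _ _ (fun p x =>
    \1_`]-oo, tm p 0] x * expR (- theta * (tm p 0 - x))) (k%:~R * h%:num)) => p.
  - exact: measurable_exp_kernel.
  - exact: (ou_integral xi_ou).
  - have := ou_integral xi_ou (tm p k); rewrite /wiener_integral_on.
    rewrite (_ : (fun x => _) = (fun x => \1_`]-oo, tm p 0] (x - k%:~R * h%:num) *
      expR (- theta * (tm p 0 - (x - k%:~R * h%:num)))))//.
    apply/funext => x; have -> : tm p k = tm p 0 + k%:~R * h%:num.
      by rewrite /tm addr0 intrD; ring.
    congr (_ * expR (_ * _)); last by ring.
    by rewrite !indicE !mem_setE !in_itv/= lerBlDr.
by apply/funext => w; apply: eq_mktuple => i; rewrite addr0.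
Qed.

(** The exponential factors as exp(-theta t) exp(-theta (nh - s)), so up to nh the kernel is a
    multiple of that of [xi] at nh; beyond nh it is that of the innovation. The coefficient 1 gives
    the shape expected by [wiener_integral_lin]. *)
Lemma ou_kernel_split (n : int) (t : I) (s : R) :
  \1_`]-oo, n%:~R * h%:num + set_val t] s *
    expR (- theta * (n%:~R * h%:num + set_val t - s)) =
  expR (- theta * set_val t) *
    (\1_`]-oo, n%:~R * h%:num] s * expR (- theta * (n%:~R * h%:num - s))) +
  1 * (\1_`](n%:~R * h%:num), (n%:~R * h%:num + set_val t)] s *
    expR (- theta * (n%:~R * h%:num + set_val t - s))).
Proof.
rewrite mul1r mulrCA -expRD -mulrDr addrA [set_val t + _]addrC -mulrDl.
congr (_ * _); rewrite !indicE !mem_setE !in_itv/=.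
have t0 : 0 <= set_val t by have := set_valP t; rewrite /= in_itv => /andP[].
have [sn|ns] := leP s (n%:~R * h%:num).
  by rewrite (le_trans sn) ?lerDl// addr0.
by rewrite add0r.
Qed.

Lemma ou_ar1_eval (n : int) (t : I) :
  {ae P, forall w, X n w t = rho theta (X (n - 1) w) t + eps n w t}.
Proof.
pose s0 : R := n%:~R * h%:num.
have mK := measurable_exp_kernel.
have lin := wiener_integral_lin W_wiener (expR (- theta * set_val t)) 1
  (mK [set` `]-oo, s0]] s0 (measurable_itv _))
  (mK [set` `]s0, (s0 + set_val t)]] (s0 + set_val t) (measurable_itv _))
  (ou_integral xi_ou s0) (eps_def n t).
have xit := ou_integral xi_ou (s0 + set_val t).
have := wiener_integral_unique W_wiener (mK [set` `]-oo, (s0 + set_val t)]]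
  (s0 + set_val t) (measurable_itv _)) xit.
move=> /(_ (fun w => expR (- theta * set_val t) * xi s0 w + 1 * eps n w t)).
rewrite [X in wiener_integral _ _ X _](_ : _ = (fun x =>
  expR (- theta * set_val t) *
    (\1_`]-oo, s0] x * expR (- theta * (s0 - x))) +
  1 * (\1_`]s0, (s0 + set_val t)] x *
    expR (- theta * (s0 + set_val t - x))))); last first.
  by apply/funext => s; exact: ou_kernel_split.
move=> /(_ lin); apply: filterS => w xiE.
rewrite X_def xiE mul1r; congr (_ * _ + _).
(* Time nh is the right endpoint of block n - 1, since nh = (n - 1)h + h. *)
rewrite X_def (_ : set_val (C0_end h) = h%:num)//.
by rewrite intrB mulrBl mul1r subrK.
Qed.

Lemma ou_ar1 : ar1_solution P theta eps X.
Proof.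
apply: ae_forall_countable => n.
have : {ae P, forall w, forall r : rat, X n w (clamp (ratr r)) =
    rho theta (X (n - 1) w) (clamp (ratr r)) + eps n w (clamp (ratr r))}.
  by apply: ae_forall_countable => r; exact: ou_ar1_eval.
by apply: filterS => w XE; apply: C0_eq_rat.
Qed.

Lemma measurable_ou_error n K : measurable_fun setT (fun w => `|X n w -
  series (fun k => iter k (rho theta) (eps (n - k%:Z) w)) K|).
Proof.
apply: measurable_C0_norm => r.
apply: (@measurable_funB _ _ _ _ (fun w => X n w _) (fun w =>
  series (fun k => iter k (rho theta) (eps (n - k%:Z) w)) K _)).
  exact: measurable_X_eval.
apply: (measurable_series_rho theta
  (F := fun k w => eps (n - k%:Z) w)) => k t.
exact: measurable_eps_eval.
Qed.

Lemma ou_error_le : {ae P, forall w, forall n K, `|X n w -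
    series (fun k => iter k (rho theta) (eps (n - k%:Z) w)) K.+1| <=
  q ^+ K * `|X (n - K.+1%:Z) w (C0_end h)|}.
Proof.
apply: filterS ou_ar1 => w Xw n K.
rewrite (ar1_series Xw) opprB addrC subrK; exact: norm_iter_rho.
Qed.

Definition ou_var := fine (\int[P]_w ((X 0 w (C0_end h)) ^+ 2)%:E)%E.

Lemma ou_varE n :
  (\int[P]_w ((X n w (C0_end h)) ^+ 2)%:E = ou_var%:E)%E.
Proof.
rewrite (@stationary_integral _ _ _ P _ _ _ ou_stationary n
  (fun x : C0 h => ((x (C0_end h)) ^+ 2)%:E)).
- rewrite /ou_var fineK//; under eq_integral do rewrite X_def.
  rewrite ge0_fin_numE.
    exact: (wiener_integral_fin W_wiener (ou_integral xi_ou _)).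
  by apply: integral_ge0 => w _; rewrite lee_fin sqr_ge0.
- apply/measurable_EFinP; apply: measurable_funX; exact: measurable_C0_eval.
- by move=> x; rewrite lee_fin sqr_ge0.
Qed.

(** Integrating the squared remainder bound gives q^(2K) times the second moment of X_(n-K-1)(h),
    which is the same for all K. *)
Lemma ou_mab_L2 n : (fun K => \int[P]_w (`|X n w - series (fun k =>
    iter k (rho theta) (eps (n - k%:Z) w)) K| ^+ 2)%:E)%E @ \oo --> 0%E.
Proof.
(* Dropping the term K = 0 matches the remainder bound, which assumes at least one application of
   [rho]. *)
rewrite -(cvg_shiftS _); set u := (fun K => _).
have bound : (fun K => ((q ^+ 2) ^+ K * ou_var)%:E) @ \oo --> 0%E.
  apply: cvg_EFin; first exact: nearW.
  rewrite -(mul0r ou_var); apply: cvgMl; apply: cvg_expr.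
  rewrite ger0_norm ?exprn_ge0 ?expR_ge0//.
  by rewrite exprn_ilt1 ?expR_ge0// contraction_lt1.
apply: (squeeze_cvge _ (cvg_cst 0%E) bound); apply: nearW => K.
apply/andP; split.
  by apply: integral_ge0 => w _; rewrite lee_fin sqr_ge0.
rewrite /u EFinM -(ou_varE (n - K.+1%:Z)) -ge0_integralZl//; last 2 first.
- apply/measurable_EFinP; apply: measurable_funX; exact: measurable_X_eval.
- by move=> w _; rewrite lee_fin sqr_ge0.
apply: ae_ge0_le_integral => //.
- apply/measurable_EFinP; apply: measurable_funX; exact: measurable_ou_error.
- move=> w _; rewrite -EFinM lee_fin mulr_ge0 ?sqr_ge0//.
- apply: emeasurable_funM => //; apply/measurable_EFinP; apply: measurable_funX.
  exact: measurable_X_eval.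
apply: filterS ou_error_le => w /(_ n K) le_w _; rewrite -EFinM lee_fin.
rewrite exprAC -[X in _ * X](real_normK (num_real _)) -exprMn.
by rewrite ler_sqr ?nnegrE// mulr_ge0// exprn_ge0// expR_ge0.
Qed.

(* The second moments of X being bounded, the sum over K of
   q^K X_(n-K-1)(h)^2 is integrable, hence finite almost surely. *)
Lemma ou_growth n : {ae P, forall w, exists z : R, forall K,
  q ^+ K * (X (n - K.+1%:Z) w (C0_end h)) ^+ 2 <= z}.
Proof.
pose f K w := (q ^+ K * (X (n - K.+1%:Z) w (C0_end h)) ^+ 2)%:E.
have f0 K w : (0 <= f K w)%E.
  by rewrite lee_fin mulr_ge0 ?sqr_ge0// exprn_ge0// expR_ge0.
have mf K : measurable_fun setT (f K).
  apply/measurable_EFinP; apply: measurable_funM => //.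
  apply: measurable_funX; exact: measurable_X_eval.
have ifK K : (\int[P]_w f K w = (q ^+ K * ou_var)%:E)%E.
  under eq_integral do rewrite /f EFinM.
  rewrite ge0_integralZl ?ou_varE//.
  - apply/measurable_EFinP; apply: measurable_funX; exact: measurable_X_eval.
  - by move=> w _; rewrite lee_fin sqr_ge0.
have fin : (\int[P]_w (\sum_(K <oo) f K w) < +oo)%E.
  rewrite integral_nneseries//.
  under eq_eseriesr do rewrite ifK.
  have q1 : `|q| < 1 by rewrite ger0_norm ?expR_ge0// contraction_lt1.
  have : (fun k => (series (geometric ou_var q) k)%:E) @ \oo -->
      (ou_var / (1 - q))%:E.
    by apply: cvg_EFin; [exact: nearW|exact: cvg_geometric_series].
  move=> geo; rewrite (_ : limn _ = (ou_var / (1 - q))%:E) ?ltry//.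
  apply/cvg_lim => //; move: geo; apply: cvg_trans; apply: near_eq_cvg.
  apply: nearW => k /=; rewrite /series/= sumEFin; congr EFin.
  by apply: eq_bigr => i _; rewrite mulrC.
have : P.-integrable setT (fun w => \sum_(K <oo) f K w)%E.
  apply/integrableP; split; first exact: ge0_emeasurable_sum.
  under eq_integral do rewrite gee0_abs ?nneseries_ge0//.
  exact: fin.
move=> /integrable_ae - /(_ measurableT); apply: filterS => w /(_ Logic.I) zfin.
exists (fine (\sum_(K <oo) f K w)%E) => K; rewrite -lee_fin fineK// -/(f K w).
apply: (@le_trans _ _ (\sum_(0 <= i < K.+1) f i w)%E).
  by rewrite big_nat_recr//= leeDr// sume_ge0.
exact: nneseries_lim_ge.
Qed.

(** The squared remainder is at most q^(2K) X_(n-K-1)(h)^2. One factor q^K absorbs the growth of the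
    squares, by [ou_growth], and the other tends to 0. *)
Lemma ou_mab_ae : {ae P, forall w, forall n, (series (fun k =>
  iter k (rho theta) (eps (n - k%:Z) w))) @ \oo --> X n w}.
Proof.
apply: filterS2 ou_error_le (ae_forall_countable ou_growth) => w err grow n.
have [z qz] := grow n.
apply: (iffRL (@cvgrPdist_lt _ (C0 h) _ \oo _ _ _)) => e e0.
have e20 : 0 < e ^+ 2 by rewrite exprn_gt0.
have /cvgrPdist_lt/(_ _ e20)[N _ NP] := @cvg_contraction _ h theta theta_gt0 z.
exists N.+1 => // -[//|K] /= NK; apply: le_lt_trans (err n K) _.
rewrite -ltr_sqr ?nnegrE ?(ltW e0) ?mulr_ge0 ?exprn_ge0 ?expR_ge0//.
rewrite exprMn (real_normK (num_real _)) expr2 -mulrA.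
have /= := NP K NK; rewrite sub0r normrN; apply: le_lt_trans.
by rewrite (le_trans _ (ler_norm _))// ler_wpM2l ?exprn_ge0 ?expR_ge0// qz.
Qed.

End ornstein_uhlenbeck_autoregression.

Theorem mainTheorem6 (R : realType) (d : measure_display)
    (Omega : measurableType d) (P : probability Omega R)
    (W : R -> Omega -> R) (theta : R) (h : {posnum R})
    (xi : R -> Omega -> R) (X eps : int -> Omega -> C0 h)
    (theta_gt0 : 0 < theta)
    (W_wiener : wiener_process P W)
    (xi_ou : ornstein_uhlenbeck P W theta xi)
    (X_def : forall n w (t : set_type `[0%R, h%:num]),
       X n w t = xi (n%:~R * h%:num + set_val t) w)
    (eps_def : innovations P W theta eps) :
  [/\ strictly_stationary P X,
      ar1_solution P theta eps X,
      mab_infty P theta eps X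
    & forall Y : int -> Omega -> C0 h,
        strictly_stationary P Y -> ar1_solution P theta eps Y ->
        {ae P, forall w, forall n, Y n w = X n w}].
Proof.
have stX := ou_stationary W_wiener xi_ou X_def.
have arX := ou_ar1 W_wiener xi_ou X_def eps_def.
split=> //.
  split=> [|n]; first exact: (ou_mab_ae theta_gt0 W_wiener xi_ou X_def eps_def).
  exact: (ou_mab_L2 theta_gt0 W_wiener xi_ou X_def eps_def).
by move=> Y sY arY; exact: (ar1_unique theta_gt0 stX arX sY arY).
Qed.
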